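(* For every countable ordinal $\beta<\omega_1$ there is a complete dependent theory $T$ in a countable language and a partial type $p(x)$ such that $T$ has a model omitting $p$ of cardinality $\geq\beth_\beta$, and every model of $T$ omitting $p$ has cardinality $<\beth_{\omega_1}$.
   Context: $\beth_0=\aleph_0$, $\beth_{\alpha+1}=2^{\beth_\alpha}$, $\beth_\delta=\sup_{\alpha<\delta}\beth_\alpha$ for limit $\delta$. A model omits a partial type if no element realizes it. A complete first-order theory is dependent (NIP) if no formula $\varphi(x,y)$ has the independence property, i.e. there is no model containing $\langle a_i: i\in\omega\rangle$ and $\langle b_s: s\subseteq\omega\rangle$ with $\varphi(a_i,b_s)$ holding iff $i\in s$. *)

(* Defs.v *)
From mathcomp Require Import all_boot.
From mathcomp Require Import boolp classical_sets functions cardinality wochoice.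

Set Implicit Arguments.
Unset Strict Implicit.
Unset Printing Implicit Defensive.

Local Open Scope classical_set_scope.
Local Open Scope card_scope.

Definition card_lt (A B : Type) : Prop :=
  ([set: A] #<= [set: B]) /\ ~ ([set: B] #<= [set: A]).

Lemma card_leTP (A B : Type) :
  ([set: A] #<= [set: B]) <-> exists f : A -> B, injective f.
Proof.
split=> [/card_leP[f]|[f finj]].
  exists (fun x => val (f (SigSub (mem_set (I : [set: A] x))))) => x y /val_inj.
  by move=> /(@inj _ _ _ f _ _ (mem_set I) (mem_set I))[].
have /injfunPex[g] : exists2 f : A -> B, set_fun setT setT f & set_inj setT f.
  by exists f => // x y _ _ /finj.
exact: inj_card_le.
Qed.

(** An ordinal is the order type of a [wellOrder]; the smaller ordinals are the
    order types of its initial segments [wo_seg a]. *)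

Record wellOrder := WellOrder {
  wo_carrier :> Type;
  wo_le : rel wo_carrier;
  wo_wo : well_order wo_le }.

Definition wo_lt (W : wellOrder) (x y : W) : Prop := ~~ wo_le y x.

Lemma wo_min (W : wellOrder) (A : set W) : A !=set0 ->
  exists2 z, A z & forall x, A x -> wo_le z x.
Proof.
move=> [x Ax]; have [|z [[zA zmin] _]] := @wo_wo W (fun x => `[< A x >]).
  by exists x; apply/asboolP.
exists z; first exact/asboolP.
by move=> y Ay; apply: zmin; apply/asboolP.
Qed.

Lemma wo_lexx (W : wellOrder) (x : W) : wo_le x x.
Proof. by have [|z -> zm] := @wo_min W [set x]; [exists x|apply: zm]. Qed.

Lemma wo_le_anti (W : wellOrder) (x y : W) : wo_le x y -> wo_le y x -> x = y.
Proof.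
move=> xy yx; have [|z [_ uz]] := @wo_wo W (fun z => `[< z = x \/ z = y >]).
  by exists x; apply/asboolP; left.
transitivity z; [apply/esym|]; apply: uz; split.
- by apply/asboolP; left.
- by move=> _ /asboolP[]->//; exact: wo_lexx.
- by apply/asboolP; right.
- by move=> _ /asboolP[]->//; exact: wo_lexx.
Qed.

Lemma wo_le_total (W : wellOrder) (x y : W) : wo_le x y \/ wo_le y x.
Proof.
have [|z [->|->] zm] := @wo_min W [set z | z = x \/ z = y].
- by exists x; left.
- by left; apply: zm; right.
- by right; apply: zm; left.
Qed.

Lemma wo_le_trans (W : wellOrder) (x y z : W) :
  wo_le x y -> wo_le y z -> wo_le x z.
Proof.
move=> xy yz.
have [|t [] -> tm] := @wo_min W [set t | [\/ t = x, t = y | t = z]].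
- by exists x; constructor 1.
- by apply: tm; constructor 3.
- by rewrite (@wo_le_anti _ x y) //; apply: tm; constructor 1.
- rewrite -(@wo_le_anti _ y z) //; by apply: tm; constructor 2.
Qed.

Lemma wo_lt_wf (W : wellOrder) : well_founded (@wo_lt W).
Proof.
move=> x; apply: contrapT => nx.
have [z nz zmin] := @wo_min W [set x | ~ Acc (@wo_lt W) x] (ex_intro _ x nx).
apply: nz; constructor => y yz; apply: contrapT => /zmin.
by move: yz; rewrite /wo_lt => /negP.
Qed.

Lemma wo_lt_asym (W : wellOrder) (x y : W) : wo_lt x y -> ~ wo_lt y x.
Proof. by move=> /negP xy /negP yx; case: (wo_le_total x y). Qed.

Lemma wo_lt_trans (W : wellOrder) (x y z : W) :
  wo_lt x y -> wo_lt y z -> wo_lt x z.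
Proof.
move=> xy /negP yz; apply/negP => zx; apply: yz.
by case: (wo_le_total y x) => [yx|xy'];
  [rewrite /wo_lt yx in xy|exact: wo_le_trans xy'].
Qed.

Lemma wo_sub_subproof (W : wellOrder) (P : set W) :
  well_order (fun x y : {x | P x} => wo_le (sval x) (sval y)).
Proof.
move=> A [x xA].
have [|_ [z Az <-] zmin] := @wo_min W [set sval x | x in [set x | x \in A]].
  by exists (sval x), x.
exists z; split; first by split=> // y yA; apply: zmin; exists y.
move=> y [yA ymin]; apply: eq_sig_hprop; first by move=> t; exact: Prop_irrelevance.
by apply: wo_le_anti; [apply: zmin; exists y|exact: ymin].
Qed.

Definition wo_sub (W : wellOrder) (P : set W) : wellOrder :=
  WellOrder (@wo_sub_subproof W P).

Definition wo_seg (W : wellOrder) (a : W) : wellOrder :=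
  wo_sub [set b | wo_lt b a].

(** [omega1] consists of the elements with countably many predecessors in some
    well-order of the uncountable type [set nat]; [omega1_seg_countable] and
    [omega1_uncountable] below characterise its order type. *)
Definition wo_powernat : wellOrder :=
  WellOrder (svalP (well_ordering_principle (set nat))).

Definition omega1 : wellOrder :=
  wo_sub [set x : wo_powernat | countable [set: wo_seg x]].

Lemma sval_injective (T : Type) (P : set T) : injective (@sval T P).
Proof. by move=> [x Px] [y Py] /= xy; exact: eq_exist. Qed.

Lemma omega1_seg_countable (a : omega1) : countable [set: wo_seg a].
Proof.
case: a => a ca; apply: (card_le_trans _ ca); apply/card_leTP => /=.
exists (fun x : @wo_seg omega1 (exist _ a ca) => exist _ (sval (sval x)) (svalP x)).
by move=> x y [] /sval_injective/sval_injective.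
Qed.

Lemma omega1_uncountable : ~ countable [set: omega1].
Proof.
move=> c1; have [call|/existsNP nall] :=
    pselect (forall x : wo_powernat, countable [set: wo_seg x]).
  have /card_leTP[f finj] : [set: set nat] #<= [set: nat].
    apply: (card_le_trans _ c1); apply/card_leTP.
    by exists (fun x => exist _ x (call x)) => x y [].
  pose D : set nat := [set n | exists2 A : set nat, f A = n & ~ A n].
  have [fD|nfD] := pselect (D (f D)); last by apply: (nfD); exists D.
  by have [A /finj ->] := fD; apply.
have [z nz zm] := @wo_min wo_powernat _ nall.
apply: nz; apply: (card_le_trans _ c1); apply/card_leTP.
have h (x : wo_seg z) : countable [set: wo_seg (sval x)].
  by apply: contrapT => /zm xz; have /negP := svalP x.
exists (fun x => exist _ (sval x) (h x)).
by move=> x y [] /sval_injective.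
Qed.

(** One step of the recursion, for an ordinal with set of predecessors [I]:
    [nat] at 0 and the power set at a successor. At a limit, the disjoint union
    of the [B i] has the cardinality of their supremum (see [beth_seg_le] and
    [beth_lim_lub]). *)
Definition beth_step (I : Type) (lt : I -> I -> Prop) (B : I -> Type) : Type :=
  match pselect (exists i : I, True) with
  | right _ => nat
  | left _ =>
    match pselect (exists m, forall i, i = m \/ lt i m) with
    | left has_max => set (B (projT1 (cid has_max)))
    | right _ => {i : I & B i}
    end
  end.

Definition beth_at (W : wellOrder) : W -> Type :=
  Fix (@wo_lt_wf W) (fun=> Type)
    (fun a B => @beth_step (wo_seg a) (@wo_lt (wo_seg a))
                  (fun b => B (sval b) (svalP b))).

(** A type of cardinality beth_alpha, where alpha is the order type of [W]. *)
Definition beth (W : wellOrder) : Type := beth_step (@wo_lt W) (@beth_at W).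

Lemma beth_atE (W : wellOrder) (a : W) : beth_at a =
  @beth_step (wo_seg a) (@wo_lt (wo_seg a)) (fun b => beth_at (sval b)).
Proof.
rewrite {1}/beth_at Fix_eq // => x f g fg; congr beth_step.
by apply/funext => b; exact: fg.
Qed.

Lemma card_le_set (A B : Type) :
  [set: A] #<= [set: B] -> [set: set A] #<= [set: set B].
Proof.
move=> /card_leTP[f finj]; apply/card_leTP; exists (fun X => f @` X) => X Y XY.
apply/seteqP; split=> x Xx.
  by have [y Yy /finj <-] : (f @` Y) (f x) by rewrite -XY; exists x.
by have [y Yy /finj <-] : (f @` X) (f x) by rewrite XY; exists x.
Qed.

Lemma beth_step_le (I I' : Type) (lt : I -> I -> Prop) (lt' : I' -> I' -> Prop)
    (B : I -> Type) (B' : I' -> Type) (g : I -> I') (g' : I' -> I) :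
    cancel g g' -> cancel g' g ->
    (forall i j, lt i j <-> lt' (g i) (g j)) ->
    (forall i j, lt' i j -> ~ lt' j i) ->
    (forall i, [set: B i] #<= [set: B' (g i)]) ->
  [set: beth_step lt B] #<= [set: beth_step lt' B'].
Proof.
move=> gK g'K glt asym BB'; rewrite /beth_step.
case: (pselect (exists i : I, _)) => [I0|nI];
  case: (pselect (exists i : I', _)) => [I'0|nI'] //.
- case: (pselect (exists m : I, _)) => [hm|nm];
    case: (pselect (exists m : I', _)) => [hm'|nm'].
  + case: (cid hm) => m mP; case: (cid hm') => m' m'P /=; apply: card_le_set.
    suff -> : m' = g m by [].
    have [//|m'm] : m' = g m \/ lt' m' (g m).
      by have [e|/glt] := mP (g' m'); [left; rewrite -e|rewrite g'K; right].
    by have [//|/(asym _ _ m'm)] := m'P (g m).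
  + case: nm'; have [m mP] := hm; exists (g m) => i'; rewrite -(g'K i').
    by have [->|/glt] := mP (g' i'); [left|right].
  + case: nm; have [m mP] := hm'; exists (g' m) => i.
    have [e|] := mP (g i); first by left; rewrite -e gK.
    by rewrite -{1}(g'K m) => /glt; right.
  + pose F i := projT1 (cid ((card_leTP _ _).1 (BB' i))).
    have Finj i : injective (F i) by rewrite /F; case: cid.
    apply/card_leTP; exists (fun x => existT _ (g (projT1 x)) (F _ (projT2 x))).
    move=> [i x] [j y] /= e; have ij : i = j.
      by apply: (can_inj gK); exact: (congr1 (@projT1 _ _) e).
    case: _ / ij in y e *; congr existT; apply: Finj.
    by have := projT2_eq e; rewrite (Prop_irrelevance (projT1_eq e) erefl).
- by case: nI'; have [i _] := I0; exists (g i).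
- by case: nI; have [i' _] := I'0; exists (g' i').
Qed.

Lemma beth_at_initial (W W' : wellOrder) (f : W -> W') :
    (forall x y, wo_lt x y <-> wo_lt (f x) (f y)) ->
    (forall x y', wo_lt y' (f x) -> exists y, f y = y') ->
  forall x, [set: beth_at x] #= [set: beth_at (f x)].
Proof.
move=> flt fdown.
have finj : injective f.
  move=> x y fxy; case: (wo_le_total x y) => xy.
    apply: wo_le_anti => //; apply/negPn/negP => /flt.
    by rewrite fxy /wo_lt wo_lexx.
  apply/esym/wo_le_anti => //; apply/negPn/negP => /flt.
  by rewrite fxy /wo_lt wo_lexx.
elim/(well_founded_ind (@wo_lt_wf W)) => x IH.
pose g (b : wo_seg x) : wo_seg (f x) := exist _ (f (sval b)) ((flt _ _).1 (svalP b)).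
have g'P (b : wo_seg (f x)) : exists c, g c = b.
  case: b => b bx; have [y yb] := fdown _ _ bx.
  have yx : wo_lt y x by apply/flt; rewrite yb.
  by exists (exist _ y yx); exact: sval_injective.
pose g' b := projT1 (cid (g'P b)).
have g'K : cancel g' g by move=> b; rewrite /g'; case: cid.
have gK : cancel g g'.
  by move=> b; apply/sval_injective/finj; have := g'K (g b) => /(congr1 sval).
rewrite !beth_atE card_eq_le; apply/andP; split.
  apply: (beth_step_le gK g'K) => [i j|i j|i].
  - exact: flt.
  - exact: wo_lt_asym.
  - by have := IH _ (svalP i); rewrite card_eq_le => /andP[].
apply: (beth_step_le g'K gK) => [i j|i j|i].
- by rewrite -{1}(g'K i) -{1}(g'K j); exact: iff_sym (flt _ _).
- exact: wo_lt_asym.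
- suff : [set: beth_at (sval (g (g' i)))] #<= [set: beth_at (sval (g' i))].
    by rewrite g'K.
  by have := IH _ (svalP (g' i)); rewrite card_eq_le => /andP[].
Qed.

(** [beth_at a] is beth of the ordinal represented by [a]. *)
Lemma beth_segE (W : wellOrder) (a : W) :
  [set: beth (wo_seg a)] #= [set: beth_at a].
Proof.
have e (b : wo_seg a) : [set: beth_at b] #= [set: beth_at (sval b)].
  apply: (@beth_at_initial (wo_seg a) W sval) => // x y yx.
  by exists (exist _ y (wo_lt_trans yx (svalP x))).
rewrite beth_atE card_eq_le; apply/andP; split;
  apply: (@beth_step_le _ _ _ _ _ _ id id) => //; try exact: wo_lt_asym.
- by move=> b; have := e b; rewrite card_eq_le => /andP[].
- by move=> b; have := e b; rewrite card_eq_le => /andP[].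
Qed.

Lemma beth_zero (W : wellOrder) : (W -> False) -> beth W = nat.
Proof. by move=> W0; rewrite /beth /beth_step; case: pselect => // -[]. Qed.

Lemma beth_succE (W : wellOrder) (m : W) : (forall x, wo_le x m) ->
  beth W = set (beth_at m).
Proof.
move=> mP; rewrite /beth /beth_step.
case: pselect => [_|[]]; last by exists m.
case: pselect => [hm|[]]; last first.
  exists m => i; have [mi|im] := boolP (wo_le m i); last by right.
  by left; exact: wo_le_anti.
by case: cid => n nP /=; have [->|/negP[]] := nP m.
Qed.

Lemma beth_succ (W : wellOrder) (m : W) : (forall x, wo_le x m) ->
  [set: beth W] #= [set: set (beth (wo_seg m))].
Proof.
move=> /beth_succE ->.
by have := beth_segE m; rewrite !card_eq_le => /andP[? ?];
  apply/andP; split; exact: card_le_set.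
Qed.

Lemma beth_limE (W : wellOrder) :
    (exists x : W, True) -> (forall x : W, exists y, wo_lt x y) ->
  beth W = {x : W & beth_at x}.
Proof.
move=> W0 Wlim; rewrite /beth /beth_step.
case: pselect => // _; case: pselect => // -[m mP].
have [y my] := Wlim m; have [ym|/(wo_lt_asym my)//] := mP y.
by move: my; rewrite ym /wo_lt wo_lexx.
Qed.

Lemma card_le_total (A B : Type) :
  ([set: A] #<= [set: B]) \/ ([set: B] #<= [set: A]).
Proof.
pose P (G : set (A * B)) := (forall a b b', G (a, b) -> G (a, b') -> b = b') /\
                            (forall a a' b, G (a, b) -> G (a', b) -> a = a').
have [F FP Ftot|G [[Gfun Ginj] Gmax]] := @Zorn_bigcup _ P.
  split=> x y z [G FG Gx] [G' FG' Gy].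
    by have [/(_ _ Gx)|/(_ _ Gy)] := Ftot _ _ FG FG' => ?;
      [apply: (FP _ FG').1|apply: (FP _ FG).1]; eauto.
  by have [/(_ _ Gx)|/(_ _ Gy)] := Ftot _ _ FG FG' => ?;
    [apply: (FP _ FG').2|apply: (FP _ FG).2]; eauto.
have [dom|/existsNP[a na]] := pselect (forall a, exists b, G (a, b)).
  by left; apply/card_leTP; have [f fP] := choice dom;
    exists f => x y fxy; apply: (Ginj _ _ (f x)); rewrite // fxy.
have [ran|/existsNP[b nb]] := pselect (forall b, exists a, G (a, b)).
  by right; apply/card_leTP; have [f fP] := choice ran;
    exists f => x y fxy; apply: (Gfun (f x)); rewrite // fxy.
case: (Gmax (G `|` [set (a, b)])).
  split; first by move=> x Gx; left.
  by move=> /(_ (a, b)) Gab; apply: na; exists b; apply: Gab; right.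
split=> [x y y' [Gy|[-> ->]] [Gy'|]|x x' y [Gx|[-> ->]] [Gx'|]] //.
- exact: Gfun Gy Gy'.
- by case=> ea _; case: na; exists y; rewrite -ea.
- by case: na; exists y'.
- by case.
- exact: Ginj Gx Gx'.
- by case=> _ eb; case: nb; exists x; rewrite -eb.
- by case: nb; exists x'.
- by case.
Qed.

Lemma card_le_square (X : Type) :
  [set: nat] #<= [set: X] -> [set: X * X] #<= [set: X].
Proof.
move=> /card_leTP[e einj].
pose ok (s : set X * (X * X -> X)) := [/\ range e `<=` s.1,
  (forall x y, s.1 x -> s.1 y -> s.1 (s.2 (x, y))) &
  (forall x y x' y', s.1 x -> s.1 y -> s.1 x' -> s.1 y' ->
    s.2 (x, y) = s.2 (x', y') -> x = x' /\ y = y')].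
pose T := {s | ok s}.
pose R0 (s t : T) : Prop := (sval s).1 `<=` (sval t).1 /\
  (forall x y, (sval s).1 x -> (sval s).1 y ->
     (sval s).2 (x, y) = (sval t).2 (x, y)).
pose r x := xget 0 [set n | e n = x].
have rK n : r (e n) = n.
  by apply: einj; rewrite /r; case: xgetP => [//|/(_ n)/(_ erefl)].
have base : ok (range e, fun p => e (pickle (r p.1, r p.2))).
  split=> //= [x y _ _|_ _ _ _ [n _ <-] [m _ <-] [n' _ <-] [m' _ <-]]; first by eexists.
  by move=> /einj/(pcan_inj pickleK); rewrite !rK => -[-> ->].
have R0trans : forall s t u, R0 s t -> R0 t u -> R0 s u.
  move=> s t u [st fst] [tu ftu]; split; first exact: subset_trans tu.
  by move=> x y sx sy; rewrite fst // ftu //; exact: st.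
pose R s t := `[< R0 s t >].
have [|s t u /asboolP st /asboolP tu|F Ftot|s smax] :=
    @ZL_preorder T (exist _ _ base) R.
- by move=> s; apply/asboolP; split.
- by apply/asboolP; exact: R0trans tu.
- have [[s0 Fs0]|F0] := pselect (exists s, F s); last first.
    by exists (exist _ _ base) => s Fs; case: F0; exists s.
  pose A x := exists2 s, F s & (sval s).1 x.
  have /choice[sel selP] p : exists s, forall t,
      [/\ F t, (sval t).1 p.1 & (sval t).1 p.2] ->
      [/\ F s, (sval s).1 p.1 & (sval s).1 p.2].
    have [[s sP]|np] := pselect (exists s,
      [/\ F s, (sval s).1 p.1 & (sval s).1 p.2]); first by exists s.
    by exists s0 => t tP; case: np; exists t.
  pose f p := (sval (sel p)).2 p.
  have tot s t : F s -> F t -> exists u, [/\ F u, R0 s u & R0 t u].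
    move=> Fs Ft; have [/asboolP st|/asboolP ts] := Ftot _ _ Fs Ft.
      by exists t; split => //; split.
    by exists s; split => //; split.
  have fE s x y : F s -> (sval s).1 x -> (sval s).1 y ->
      f (x, y) = (sval s).2 (x, y).
    move=> Fs sx sy; rewrite /f.
    have [Ft tx ty] : [/\ F (sel (x, y)), (sval (sel (x, y))).1 x &
                                        (sval (sel (x, y))).1 y].
      exact: (selP (x, y) s).
    by have [u [Fu [_ su] [_ ->]]] := tot _ _ Fs Ft; rewrite // su.
  have common x y : A x -> A y -> exists s, [/\ F s, (sval s).1 x & (sval s).1 y].
    move=> [s Fs sx] [t Ft ty]; have [u [Fu [su _] [tu _]]] := tot _ _ Fs Ft.
    by exists u; split; [|exact: su|exact: tu].
  have okf : ok (A, f).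
    split=> /= [x ex|x y Ax Ay|x y x' y' Ax Ay Ax' Ay'].
    - by exists s0 => //; have [+ _ _] := svalP s0; apply.
    - have [s [Fs sx sy]] := common _ _ Ax Ay; rewrite (fE s) //.
      by exists s => //; have [_ + _] := svalP s; apply.
    - have [s [Fs sx sy]] := common _ _ Ax Ay.
      have [t [Ft tx ty]] := common _ _ Ax' Ay'.
      have [u [Fu [su _] [tu _]]] := tot _ _ Fs Ft.
      rewrite !(fE u) //; try (exact: su); try (exact: tu).
      by have [_ _ uinj] := svalP u; apply: uinj; (exact: su || exact: tu).
  exists (exist _ _ okf) => s Fs; apply/asboolP; split=> /= [x sx|x y sx sy].
    by exists s.
  by rewrite (fE s).
case: s smax => -[A f] okf smax; have [/= eA fA finj] := okf.
have A0 : A (e 0) by apply: eA; exists 0.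
have A1 : A (e 1) by apply: eA; exists 1.
have e01 : e 0 <> e 1 by move=> /einj.
have [|] := card_le_total {x | ~ A x} {x | A x} => /card_leTP[j jinj].
  pose h x := if pselect (A x) is right nAx then f (e 1, sval (j (exist _ x nAx)))
              else f (e 0, x).
  have hA x : A (h x).
    by rewrite /h; case: pselect => Ax; apply: fA => //; exact: svalP.
  have hinj : injective h.
    move=> x y; rewrite /h; case: pselect => Ax; case: pselect => Ay.
    + by move=> /finj[].
    + by move=> /finj[]//; exact: svalP.
    + by move=> /esym/finj[]//; exact: svalP.
    + by move=> /finj[]//; try exact: svalP; move=> _ /sval_injective/jinj[].
  apply/card_leTP; exists (fun p => f (h p.1, h p.2)) => -[x y] [x' y'] /=.
  by move=> /finj[]// /hinj -> /hinj ->.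
pose i x := if pselect (A x) is left Ax then sval (j (exist _ x Ax)) else x.
have iC x : A x -> ~ A (i x).
  by move=> Ax; rewrite /i; case: pselect => // Ax'; exact: (svalP (j _)).
have iinj x y : A x -> A y -> i x = i y -> x = y.
  move=> Ax Ay; rewrite /i; case: pselect => // Ax'; case: pselect => // Ay'.
  by move=> /sval_injective/jinj[].
pose B x := A x \/ exists2 a, A a & i a = x.
have /choice[k kP] x : exists a, B x -> ~ A x -> A a /\ i a = x.
  have [[a Aa ax]|nx] := pselect (exists2 a, A a & i a = x); first by exists a.
  by exists x => -[].
pose h x := if pselect (A x) is left _ then f (e 0, x) else f (e 1, k x).
have hA x : B x -> A (h x).
  move=> Bx; rewrite /h; case: pselect => Ax; apply: fA => //.
  by have [] := kP _ Bx Ax.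
have hinj x y : B x -> B y -> h x = h y -> x = y.
  move=> Bx By; rewrite /h; case: pselect => Ax; case: pselect => Ay.
  - by move=> /finj[].
  - by have [Ak _] := kP _ By Ay; move=> /finj[].
  - by have [Ak _] := kP _ Bx Ax; move=> /esym/finj[].
  - have [Akx ikx] := kP _ Bx Ax; have [Aky iky] := kP _ By Ay.
    by move=> /finj[]// _ kxy; rewrite -ikx kxy.
pose g p := if pselect (A p.1 /\ A p.2) is left _ then f p else i (f (h p.1, h p.2)).
have okg : ok (B, g).
  split=> /= [x /eA Ax|x y Bx By|x y x' y' Bx By Bx' By'].
  - by left.
  - rewrite /g; case: pselect => /= [[Ax Ay]|_]; [left|right]; first exact: fA.
    by exists (f (h x, h y)) => //; apply: fA; exact: hA.
  - have hh z t : B z -> B t -> A (f (h z, h t)).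
      by move=> Bz Bt; apply: fA; exact: hA.
    rewrite /g; case: pselect => /= [[Ax Ay]|_]; case: pselect => /= [[Ax' Ay']|_].
    + exact: finj.
    + by move=> E; case: (iC _ (hh _ _ Bx' By')); rewrite -E; exact: fA.
    + by move=> E; case: (iC _ (hh _ _ Bx By)); rewrite E; exact: fA.
    + move=> /(iinj _ _ (hh _ _ Bx By) (hh _ _ Bx' By'))/finj[]; try exact: hA.
      by move=> /(hinj _ _ Bx Bx')-> /(hinj _ _ By By')->.
have /asboolP[/(_ (i (e 0)))/= BA _] : R (exist _ _ okg) (exist _ _ okf).
  apply: smax; apply/asboolP; split=> /= [x Ax|x y Ax Ay]; first by left.
  by rewrite /g; case: pselect => // -[].
by case: (iC _ A0); apply: BA; right; exists (e 0).
Qed.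

Lemma beth_seg_le (W : wellOrder) (a : W) :
    (forall x : W, exists y, wo_lt x y) ->
  [set: beth (wo_seg a)] #<= [set: beth W].
Proof.
move=> Wlim; rewrite (card_le_eql (beth_segE a)) beth_limE //.
apply/card_leTP; exists (fun x => existT _ a x) => x y e.
by have := projT2_eq e; rewrite (Prop_irrelevance (projT1_eq e) erefl).
Qed.

Lemma beth_lim_lub (W : wellOrder) (X : Type) :
    (exists x : W, True) -> (forall x : W, exists y, wo_lt x y) ->
    [set: W] #<= [set: set nat] ->
    (forall a : W, [set: beth (wo_seg a)] #<= [set: X]) ->
  [set: beth W] #<= [set: X].
Proof.
move=> W0 Wlim cW WX; have [x0 _] := W0.
have [a _ am] := @wo_min W setT (ex_intro _ x0 I).
have [b ab bm] := @wo_min W [set b | wo_lt a b] (Wlim a).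
have a0 (x : wo_seg a) : False by have /negP := svalP x; apply; exact: am.
have natX : [set: nat] #<= [set: X] by have := WX a; rewrite (beth_zero a0).
have WX' (c : W) : [set: beth_at c] #<= [set: X].
  by have := WX c; rewrite (card_le_eql (beth_segE c)).
have setX : [set: set nat] #<= [set: X].
  apply: card_le_trans (WX b).
  have bmax (x : wo_seg b) : wo_le x (exist _ a ab : wo_seg b).
    apply/negPn/negP => xa; have /negP := svalP x; apply; apply: bm.
    exact: xa.
  rewrite (card_le_eqr (beth_succ bmax)) beth_zero // => -[x /= xa].
  by have /negP := xa; apply; apply: am.
rewrite beth_limE //.
have /card_leTP[s sinj] := card_le_square natX.
have /card_leTP[i iinj] := card_le_trans cW setX.
pose F c := projT1 (cid ((card_leTP _ _).1 (WX' c))).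
have Finj c : injective (F c) by rewrite /F; case: cid.
apply/card_leTP; exists (fun x => s (i (projT1 x), F _ (projT2 x))).
move=> [x u] [y v] /= /sinj[/iinj xy]; case: _ / xy in v *.
by move=> /Finj ->.
Qed.

Lemma omega1_le_powernat : [set: omega1] #<= [set: set nat].
Proof. by apply/card_leTP; exists sval; exact: sval_injective. Qed.

Lemma omega1_limit (x : omega1) : exists y : omega1, wo_lt x y.
Proof.
apply: contrapT => /forallNP xmax; apply: omega1_uncountable.
have /card_leTP[f finj] := omega1_seg_countable x.
apply/card_leTP; exists (fun y => if pselect (wo_lt y x) is left yx
  then (f (exist _ y yx)).+1 else 0) => y z.
have eqx t : ~ wo_lt t x -> t = x.
  move=> /negP/negPn xt; apply: wo_le_anti => //.
  by apply/negPn/negP => xt'; exact: (xmax t).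
case: pselect => yx; case: pselect => zx //.
  by move=> [/finj[]].
by rewrite (eqx _ yx) (eqx _ zx).
Qed.

Record language := Language {
  fsym : Type;
  farity : fsym -> nat;
  rsym : Type;
  rarity : rsym -> nat }.

Definition countable_language (L : language) : Prop :=
  countable [set: fsym L] /\ countable [set: rsym L].

Inductive term (L : language) (n : nat) : Type :=
| Var of 'I_n
| App (f : fsym L) of ('I_(farity f) -> term L n).

(** [formula L n]: formulas whose free variables are among 0, ..., n-1; [All]
    binds variable 0 of its body. *)
Inductive formula (L : language) (n : nat) : Type :=
| Bot
| Eql of term L n & term L n
| Rel (r : rsym L) of ('I_(rarity r) -> term L n)
| Imp of formula L n & formula L n
| All of formula L n.+1.

Arguments Bot {L n}.

Definition Neg (L : language) (n : nat) (phi : formula L n) : formula L n :=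
  Imp phi Bot.

Notation sentence L := (formula L 0).
Notation theory L := (set (sentence L)).

Record structure (L : language) := Structure {
  dom :> Type;
  dom_inhabited : inhabited dom;
  fint : forall f : fsym L, ('I_(farity f) -> dom) -> dom;
  rint : forall r : rsym L, ('I_(rarity r) -> dom) -> Prop }.

Fixpoint eval (L : language) (M : structure L) (n : nat) (v : 'I_n -> M)
    (t : term L n) : M :=
  match t with
  | Var i => v i
  | App f ts => @fint L M f (fun i => eval v (ts i))
  end.

Definition vcons (D : Type) (n : nat) (x : D) (v : 'I_n -> D) : 'I_n.+1 -> D :=
  fun i => if unlift ord0 i is Some j then v j else x.

Definition vcat (D : Type) (n m : nat) (a : 'I_n -> D) (b : 'I_m -> D) :
    'I_(n + m) -> D :=
  fun i => match fintype.split i with inl j => a j | inr k => b k end.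

Definition vnil (D : Type) : 'I_0 -> D.
Proof. by case. Defined.

Fixpoint sat (L : language) (M : structure L) (n : nat) (phi : formula L n) :
    ('I_n -> M) -> Prop :=
  match phi with
  | Bot => fun=> False
  | Eql s t => fun v => eval v s = eval v t
  | Rel r ts => fun v => @rint L M r (fun i => eval v (ts i))
  | Imp phi psi => fun v => sat phi v -> sat psi v
  | All phi => fun v => forall x : M, sat phi (vcons x v)
  end.

Definition holds (L : language) (M : structure L) (phi : sentence L) : Prop :=
  sat phi (@vnil M).

Definition models (L : language) (M : structure L) (T : theory L) : Prop :=
  forall phi, T phi -> holds M phi.

Definition entails (L : language) (T : theory L) (phi : sentence L) : Prop :=
  forall M : structure L, models M T -> holds M phi.

Definition complete (L : language) (T : theory L) : Prop :=
  (exists M : structure L, models M T) /\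
  (forall phi : sentence L, entails T phi \/ entails T (Neg phi)).

Definition independence_property (L : language) (T : theory L) (n m : nat)
    (phi : formula L (n + m)) : Prop :=
  exists2 M : structure L, models M T &
    exists (a : nat -> 'I_n -> M) (b : set nat -> 'I_m -> M),
      forall i s, sat phi (vcat (a i) (b s)) <-> s i.

Definition dependent (L : language) (T : theory L) : Prop :=
  forall (n m : nat) (phi : formula L (n + m)), ~ independence_property T phi.

Definition realizes (L : language) (M : structure L) (x : M)
    (p : set (formula L 1)) : Prop :=
  forall phi, p phi -> sat phi (fun=> x).

Definition omits (L : language) (M : structure L) (p : set (formula L 1)) :
    Prop :=
  forall x : M, ~ realizes x p.

(** Consistency of [p] with [T], in the finitary form. *)
Definition partial_type (L : language) (T : theory L)
    (p : set (formula L 1)) : Prop :=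
  forall q : set (formula L 1), finite_set q -> q `<=` p ->
    exists2 M : structure L, models M T & exists x : M, realizes x q.

(* Main.v *)
Require Import Defs.
From mathcomp Require Import all_boot all_order all_algebra.
From mathcomp Require Import boolp classical_sets functions cardinality wochoice.
From mathcomp Require Import zify lra.

(** The model is the sum of [rat], whose elements are named, and of linearly
    ordered levels [P a], for [a] in [beta], each carrying a binary tree over the
    sum [L] of the preceding levels: an element [x] of [P a] has a well-ordered
    set [S x] of elements of [L], and [diff x y i] says that [i] is the first
    difference of [S x] and [S y]. The type to omit says that [x] is not named
    and lies in no level.

    In any model omitting it, each graph [diff _ _ i] is a disjoint union of
    complete bipartite graphs, so [x] is determined by its side in all of them
    and a level is at most the power set of what precedes it. In the intended
    model every subset of [L] yields an element of [P a], so that the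
    cardinality is at least [beth beta].

    NIP needs the order of [P a] to be independent of its tree: every ball
    [{y | diff x y i}] is dense in [P a]. To achieve this, the germ at infinity
    of [S x] codes a finite word, and [P a] is ordered by these words, while a
    ball only restricts a bounded part of [S x]. The reducts to finite
    sublanguages then admit back-and-forth, and the one-point extensions of a
    set of [n] elements fall into polynomially many isomorphism types. *)

Set Implicit Arguments.
Unset Strict Implicit.
Unset Printing Implicit Defensive.

Local Open Scope classical_set_scope.
Local Open Scope card_scope.

(** The language contains [diff] but not membership in [S x]: flipping branches one point after
    another realises every pattern on a finite subset of [L], so membership would have the
    independence property. The relation [diff] still controls the size of a level, because the tree
    is binary.

    The levels are dense orders, so first differences exist only because the sets [S x] are
    well-ordered. An arbitrary subset of [L] need not be well-ordered; it enters an element as a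
    coordinate of a letter of its word, not as its branch.

    The word must be recoverable from [S x], or distinct elements would share a branch. Hence every
    level carries a partial decoding map with cofinal fibres and well-ordered domain, and the
    existence of this map is part of the induction hypothesis of the construction.

    In a model omitting the type, the bounds found level by level are indexed by ordinals below
    [omega1]; there are countably many of them, so a single such ordinal bounds them all. *)

(** * Linear orders of branches *)

Record relType := RelType { rel_sort :> Type; rlt : rel_sort -> rel_sort -> Prop }.

Definition strict_linear (L : relType) :=
  [/\ forall x : L, ~ rlt x x,
      forall x y z : L, rlt x y -> rlt y z -> rlt x z
    & forall x y : L, [\/ x = y, rlt x y | rlt y x]].

Definition wo_subset (L : relType) (A : set L) :=
  forall B : set L, B `<=` A -> B !=set0 ->
    exists2 m, B m & forall x, B x -> ~ rlt x m.

(** [K] is a partial map from [L] to [T], decoding [c] to [t]. Cofinal fibres allow a subset of [T]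
    to be recovered from the part of its preimage above any bound; the well-ordered domain makes
    every such preimage well-ordered, as a branch must be. *)
Definition cofinal_fibres (T : Type) (L : relType) (K : T -> L -> Prop) :=
  [/\ forall s t c, K s c -> K t c -> s = t,
      forall t i, exists2 c, rlt i c & K t c
    & wo_subset [set c | exists t, K t c]].

Definition splits_at (L : relType) (A B : set L) (i : L) :=
  (forall j, rlt j i -> (A j <-> B j)) /\ (A i <-> ~ B i).

(** [None] stands for minus infinity on the left and plus infinity on the right, so that density
    statements also give the absence of endpoints. *)
Definition ltO (X : relType) (u v : option X) : Prop :=
  match u, v with Some x, Some y => rlt x y | _, _ => True end.

(** [S x] is a branch of the binary tree whose levels are the elements of [L]. *)
Definition branches_over (L X : relType) :=
  strict_linear X /\ exists S : X -> set L,
  [/\ forall x y, x <> y -> exists i, splits_at (S x) (S y) i,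
      forall x i u v, ltO u v -> exists y,
        [/\ ltO u (Some y), ltO (Some y) v & splits_at (S x) (S y) i],
      inhabited X,
      [set: set L] #<= [set: X]
    & exists K : L + X -> X -> Prop, cofinal_fibres K].

Lemma wo_subsetU (L : relType) (A B : set L) : strict_linear L ->
  wo_subset A -> wo_subset B -> wo_subset (A `|` B).
Proof.
move=> [irr tr tot] woA woB C CAB [c Cc].
have woI (E F : set L) : wo_subset E -> (C `&` E) !=set0 ->
    exists2 m, (C `&` E) m & forall x, C x -> E x -> ~ rlt x m.
  move=> woE nE; have [|m mE mP] := woE (C `&` E) _ nE; first by move=> x [].
  by exists m => // x Cx Ex; apply: mP.
have [nA|nA] := pselect ((C `&` A) !=set0); last first.
  have CB : C `<=` B by move=> x Cx; have [Ax|//] := CAB _ Cx; case: nA; exists x.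
  by apply: woB => //; exists c.
have [nB|nB] := pselect ((C `&` B) !=set0); last first.
  have CA : C `<=` A by move=> x Cx; have [//|Ax] := CAB _ Cx; case: nB; exists x.
  by apply: woA => //; exists c.
have [m [Cm Am] mP] := woI _ B woA nA; have [n [Cn Bn] nP] := woI _ A woB nB.
have [mn|mn|nm] := tot m n.
- by exists m => // x Cx; have [Ax|Bx] := CAB _ Cx; [apply: mP|rewrite mn; apply: nP].
- exists m => // x Cx; have [Ax|Bx] := CAB _ Cx; first exact: mP.
  by move=> xm; apply: (nP _ Cx Bx); apply: tr mn.
- exists n => // x Cx; have [Ax|Bx] := CAB _ Cx; last exact: nP.
  by move=> xn; apply: (mP _ Cx Ax); apply: tr nm.
Qed.

Lemma wo_subsetS (L : relType) (A B : set L) : A `<=` B -> wo_subset B -> wo_subset A.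
Proof. by move=> AB woB C CA; apply: woB; exact: subset_trans AB. Qed.

Lemma wo_subset1 (L : relType) (a : L) : strict_linear L -> wo_subset [set a].
Proof.
by move=> [irr _ _] B Ba [b Bb]; exists b => // x /Ba ->; rewrite (Ba _ Bb).
Qed.

(** * Cardinal arithmetic of infinite sets *)

Lemma card_le_prod (A B C : Type) : [set: nat] #<= [set: C] ->
  [set: A] #<= [set: C] -> [set: B] #<= [set: C] -> [set: A * B] #<= [set: C].
Proof.
move=> /card_le_square/card_leTP[s sinj] /card_leTP[f finj] /card_leTP[g ginj].
apply/card_leTP; exists (fun p => s (f p.1, g p.2)) => -[a b] [a' b'] /= /sinj[].
by move=> /finj -> /ginj ->.
Qed.

Lemma card_le_seq (C : Type) : [set: nat] #<= [set: C] ->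
  [set: seq C] #<= [set: C].
Proof.
move=> natC; have /card_leTP[s sinj] := card_le_square natC.
have /card_leTP[e einj] := natC; apply/card_leTP.
exists (foldr (fun c r => s (e 1, s (c, r))) (s (e 0, e 0))).
elim=> [|c r IH] [|c' r'] //=.
- by move=> /sinj[] /einj.
- by move=> /sinj[] /einj.
- by move=> /sinj[] /sinj[-> /IH ->].
Qed.

Lemma card_le_countable (T : countType) (C : Type) :
  [set: nat] #<= [set: C] -> [set: T] #<= [set: C].
Proof.
by move=> natC; apply: card_le_trans natC; apply/card_leTP; exists (@pickle T);
   exact: pcan_inj (@pickleK T).
Qed.

Lemma set1_inj (T : Type) : injective (@set1 T).
Proof. by move=> x y xy; have : [set x] x by []; rewrite xy. Qed.

Lemma card_le_powerset (T : Type) : [set: T] #<= [set: set T].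
Proof. by apply/card_leTP; exists set1; exact: set1_inj. Qed.

(** * Words and branches over one linear order *)

Section BranchOrder.
Import Order.TTheory GRing.Theory Num.Theory.

Variables (L : relType) (K : L -> L -> Prop).
Hypotheses (linL : strict_linear L) (fibK : cofinal_fibres K).
Hypothesis natL : [set: nat] #<= [set: L].

Definition pow_wo : wellOrder :=
  WellOrder (svalP (well_ordering_principle (set L))).

(** The natural number makes the one-letter words cofinal, the subset of [L] makes the order as
    large as the power set, and the rational makes it dense without endpoints. Subsets are
    well-ordered so that the codes of [branch_fibre] are. *)
Definition symbol := (nat * pow_wo * rat)%type.

Definition sym_lt (s t : symbol) : Prop :=
  (s.1.1 < t.1.1)%N \/ s.1.1 = t.1.1 /\
    (wo_lt s.1.2 t.1.2 \/ s.1.2 = t.1.2 /\ (s.2 < t.2)%R).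

(** The rational 0 is reserved for the padding in [symb], so that the end of a word can be read off
    its symbols. *)
Definition letter (s : symbol) : Prop := s.2 <> 0%R.

Lemma wo_lt_irr (W : wellOrder) (x : W) : ~ wo_lt x x.
Proof. by rewrite /wo_lt wo_lexx. Qed.

Lemma wo_lt_total (W : wellOrder) (x y : W) : [\/ x = y, wo_lt x y | wo_lt y x].
Proof.
have [xy|yx] := boolP (wo_le x y); last by constructor 3.
have [yx|xy'] := boolP (wo_le y x); last by constructor 2.
by constructor 1; exact: wo_le_anti.
Qed.

Lemma sym_irr s : ~ sym_lt s s.
Proof.
by case=> [|[_ [|[_]]]]; [rewrite ltnn|exact: wo_lt_irr|rewrite ltxx].
Qed.

Lemma sym_trans s t u : sym_lt s t -> sym_lt t u -> sym_lt s u.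
Proof.
move: s t u => [[n a] q] [[n' a'] q'] [[n'' a''] q''].
rewrite /sym_lt /= => -[nn'|[-> aa']] [nn''|[<- aa'']].
- by left; exact: ltn_trans nn''.
- by left.
- by left.
right; split=> //; case: aa' aa'' => [aa'|[-> qq']] [aa''|[<- qq'']].
- by left; exact: wo_lt_trans aa''.
- by left.
- by left.
- by right; split => //; exact: lt_trans qq''.
Qed.

Lemma sym_total s t : [\/ s = t, sym_lt s t | sym_lt t s].
Proof.
move: s t => [[n a] q] [[n' a'] q']; rewrite /sym_lt /=.
have [nn'|nn'|->] := ltngtP n n'; [by constructor 2; left|by constructor 3; left|].
have [->|aa'|aa'] := wo_lt_total a a'; last 2 first.
- by constructor 2; right; split=> //; left.
- by constructor 3; right; split=> //; left.
have [qq'|qq'|->] := ltgtP q q'; [constructor 2|constructor 3|by constructor 1].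
  by right; split => //; right.
by right; split => //; right.
Qed.

Lemma sym_above s : exists2 c, sym_lt s c & letter c.
Proof.
case: s => [[n a] q]; exists (n, a, `|q| + 1)%R; last first.
  by rewrite /letter /=; have := normr_ge0 q; lra.
by right; split=> //; right; split=> //=; have := ler_norm q; lra.
Qed.

Lemma sym_below s : exists2 c, sym_lt c s & letter c.
Proof.
case: s => [[n a] q]; exists (n, a, - `|q| - 1)%R; last first.
  by rewrite /letter /=; have := normr_ge0 q; lra.
right; split=> //; right; split=> //=.
by have := ler_norm (- q); rewrite normrN; lra.
Qed.

Lemma sym_between s t : sym_lt s t ->
  exists c, [/\ sym_lt s c, sym_lt c t & letter c].
Proof.
case: s => [[n a] q]; case: t => [[n' a'] q'] st.
have [[->  [-> qq']]|nst] := pselect (n = n' /\ a = a' /\ (q < q')%R).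
  pose m := ((q + q') / 2)%R.
  have [qm mq'] : (q < m)%R /\ (m < q')%R by rewrite /m; split; lra.
  (* The midpoint may be 0 and thus no letter; then the midpoint of [q] and [m] is negative and
     serves instead. *)
  have [m0|m0] := eqVneq m 0%R; last first.
    exists (n', a', m); split; last exact/eqP.
      by right; split => //; right.
    by right; split => //; right.
  exists (n', a', (q + m) / 2)%R; split; rewrite /letter /=; last by lra.
    by right; split => //; right; split=> //=; lra.
  by right; split => //; right; split=> //=; lra.
(* Here [s] and [t] already differ before the rational coordinate, so the rational of [s] can be
   raised freely. *)
exists (n, a, `|q| + 1)%R; split.
- by right; split=> //; right; split=> //=; have := ler_norm q; lra.
- case: st => [?|[/= e [?|[/= e' qq']]]]; first by left.
    by right; split => //; left.
  by case: nst.
- by rewrite /letter /=; have := normr_ge0 q; lra.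
Qed.

(** Words are finite over an alphabet no larger than the power set of [L], so each can be named by a
    subset of [L]. *)
Let hasL : exists h : seq symbol -> set L, injective h.
Proof.
apply/card_leTP.
have natP : [set: nat] #<= [set: set L].
  exact: card_le_trans natL (card_le_powerset L).
apply: card_le_trans (card_le_seq natP).
have /card_leTP[f finj] : [set: symbol] #<= [set: set L].
  apply: card_le_prod => //; last exact: card_le_countable.
  exact: card_le_prod.
by apply/card_leTP; exists (map f); exact: inj_map.
Qed.

Let h := projT1 (cid hasL).
Let h_inj : injective h. Proof. by rewrite /h; case: cid. Qed.

(** Since the fibres of [K] are cofinal, [w] is recovered from the germ at
    infinity of [code w]. *)
Definition code (w : seq symbol) : set L := [set c | exists2 l, h w l & K l c].

Lemma wo_code w : wo_subset (code w).
Proof.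
case: fibK => _ _; apply: wo_subsetS => c [l _ Klc]; exists l; exact: Klc.
Qed.

(** Every [l] has a code above [i], and this code decodes to nothing else; so membership of [l] in
    [h w] is visible above [i]. *)
Lemma code_germ_inj w w' i :
  (forall j, rlt i j -> (code w j <-> code w' j)) -> w = w'.
Proof.
have [Kfun Kcof _] := fibK; move=> ww'.
have sub v v' : (forall j, rlt i j -> code v j -> code v' j) -> h v `<=` h v'.
  move=> vv' l vl; have [c ic Klc] := Kcof l i.
  have [|l' v'l' Kl'c] := vv' c ic; first by exists l.
  by rewrite (Kfun _ _ _ Klc Kl'c).
by apply: h_inj; apply/seteqP; split; apply: sub => j /ww' [].
Qed.

Definition is_branch (x : seq symbol * set L) :=
  [/\ forall k, (k < size x.1)%N -> letter (nth (0, set0, 0%R) x.1 k),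
      wo_subset x.2 &
      exists i, forall j, rlt i j -> (x.2 j <-> code x.1 j)].

Definition branch := {x | is_branch x}.

Definition word (x : branch) := (sval x).1.
Definition path_of (x : branch) := (sval x).2.
(** The word is continued by a constant symbol carrying the branch itself, so that elements with the
    same word are still compared, by the well-order on subsets. *)
Definition symb (x : branch) (k : nat) : symbol :=
  nth (0, path_of x, 0%R) (word x) k.

Lemma symb_letter x k : letter (symb x k) <-> (k < size (word x))%N.
Proof.
split=> [|kx]; last first.
  have [+ _ _] := svalP x => /(_ k kx).
  by rewrite /symb (set_nth_default (0, set0, 0%R)).
by apply: contraPT; rewrite -leqNgt => kx; rewrite /symb nth_default.
Qed.

Lemma path_inj x y : path_of x = path_of y -> x = y.
Proof.
move=> xy; apply: sval_injective; rewrite [LHS]surjective_pairing.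
rewrite [RHS]surjective_pairing -/(path_of x) -/(path_of y) xy.
congr pair.
have [_ _ [i ix]] := svalP x; have [_ _ [j jy]] := svalP y.
have [_ tr tot] := linL.
have [k [ik jk]] : exists k, (forall l, rlt k l -> rlt i l) /\
                              (forall l, rlt k l -> rlt j l).
  have [ij|ij|ji] := tot i j.
  - by exists i; split=> // l; rewrite ij.
  - by exists j; split=> // l; exact: tr.
  - by exists i; split=> // l; exact: tr.
apply: (@code_germ_inj _ _ k) => l kl.
have xl : (sval x).2 l <-> (sval y).2 l by rewrite -/(path_of x) xy.
by apply: iff_trans (iff_trans xl (jy l (jk _ kl))); exact: iff_sym (ix l (ik _ kl)).
Qed.

Lemma symb_inj x y : symb x =1 symb y -> x = y.
Proof.
move=> xy; have sz : size (word x) = size (word y).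
  apply/eqP; rewrite eqn_leq; apply/andP; split; rewrite leqNgt; apply/negP.
    by move=> /symb_letter; rewrite xy => /symb_letter; rewrite ltnn.
  by move=> /symb_letter; rewrite -xy => /symb_letter; rewrite ltnn.
apply: path_inj; have := xy (size (word x)).
by rewrite /symb !nth_default ?sz // => -[].
Qed.

Definition branch_lt (x y : branch) := exists2 k,
  (forall j, (j < k)%N -> symb x j = symb y j) & sym_lt (symb x k) (symb y k).

Definition branch_order := RelType branch_lt.

Lemma branch_linear : strict_linear branch_order.
Proof.
split=> [x [k _]|x y z [k xyk xy] [l yzl yz]|x y]; first exact: sym_irr.
  have [kl|lk|kl] := ltngtP k l.
  - exists k => [j jk|]; last by rewrite -yzl.
    by rewrite xyk // yzl // (ltn_trans jk).
  - exists l => [j jl|]; last by rewrite xyk.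
    by rewrite xyk ?yzl // (ltn_trans jl).
  - subst l; exists k => [j jk|]; last exact: sym_trans yz.
    by rewrite xyk ?yzl.
have [->|xy] := pselect (x = y); first by constructor 1.
have dif : exists k, `[< symb x k <> symb y k >].
  apply: contrapT => nk; apply: xy; apply: symb_inj => k.
  by apply: contrapT => kxy; apply: nk; exists k; apply/asboolP.
case: (ex_minnP dif) => k /asboolP kxy kmin.
have low j : (j < k)%N -> symb x j = symb y j.
  by move=> jk; apply: contrapT => /asboolP/kmin; rewrite leqNgt jk.
have [//|xyk|yxk] := sym_total (symb x k) (symb y k).
  by constructor 2; exists k.
by constructor 3; exists k => // j /low.
Qed.

(** The word alone places an element in the interval, whatever the bounded part of its branch; this
    is how the order becomes independent of the tree. *)
Lemma word_between (u v : option branch) :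
    @ltO branch_order u v ->
  exists2 w : seq symbol,
    (forall k, (k < size w)%N -> letter (nth (0, set0, 0%R) w k)) &
    forall z : branch, word z = w ->
      @ltO branch_order u (Some z) /\ @ltO branch_order (Some z) v.
Proof.
have one c : letter c -> forall k, (k < size [:: c])%N ->
  letter (nth (0, set0, 0%R) [:: c] k) by move=> lc [].
have first c z : word z = [:: c] -> symb z 0 = c by rewrite /symb => ->.
case: u v => [u|] [v|] /=; last 1 first.
- exists [::] => //.
- move=> [k uvk uv]; have [c [uc cv lc]] := sym_between uv.
  (* Before their first difference [u] and [v] have only letters: a common padding symbol would give
     them the same branch. *)
  have ku j : (j < k)%N -> (j < size (word u))%N.
    move=> jk; apply: contrapT => /negP ju.
    have uj : ~ letter (symb u j) by move=> /symb_letter; exact/negP.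
    have vj : ~ letter (symb v j) by rewrite -uvk.
    suff uvE : u = v by move: uv; rewrite uvE => /sym_irr.
    apply: path_inj; have := uvk j jk; rewrite /symb !nth_default; first by case.
      by rewrite leqNgt; apply/negP => /symb_letter.
    by rewrite leqNgt; apply/negP => /symb_letter.
  exists (rcons (mkseq (symb u) k) c) => [j|z zw].
    rewrite size_rcons size_mkseq ltnS nth_rcons size_mkseq => jk.
    case: ltnP => [jk'|kj]; last by rewrite eqn_leq jk kj.
    by rewrite nth_mkseq //; apply/symb_letter; exact: ku.
  have zlow j : (j < k)%N -> symb z j = symb u j.
    by move=> jk; rewrite /symb zw nth_rcons size_mkseq jk nth_mkseq.
  have zk : symb z k = c by rewrite /symb zw nth_rcons size_mkseq ltnn eqxx.
  split; first by exists k; [move=> j /zlow|rewrite zk].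
  by exists k; [move=> j jk; rewrite zlow // uvk|rewrite zk].
- have [c uc lc] := sym_above (symb u 0); exists [:: c]; first exact: one.
  by move=> z /first zc; split=> //; exists 0 => //; rewrite zc.
- have [c uc lc] := sym_below (symb v 0); exists [:: c]; first exact: one.
  by move=> z /first zc; split=> //; exists 0 => //; rewrite zc.
Qed.

(** The symmetric difference lies in a union of two well-ordered sets, hence has a least element. *)
Lemma branch_splits x y : x <> y -> exists i, splits_at (path_of x) (path_of y) i.
Proof.
move=> xy; have [irr tr tot] := linL.
pose D : set L := [set j | ~ (path_of x j <-> path_of y j)].
have [[d Dd]|D0] := pselect (D !=set0); last first.
  case: xy; apply: path_inj; apply/seteqP; split=> j xj.
    by apply: contrapT => yj; apply: D0; exists j => /= -[/(_ xj)].
  by apply: contrapT => yj; apply: D0; exists j => /= -[_ /(_ xj)].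
have [_ wox _] := svalP x; have [_ woy _] := svalP y.
have [|i Di imin] := (wo_subsetU linL wox woy) D _ (ex_intro _ d Dd).
  move=> j /= Dj; rewrite -/(path_of x) -/(path_of y).
  have [xj|xj] := pselect (path_of x j); first by left.
  by right; apply: contrapT => yj; apply: Dj.
exists i; split; first by move=> j ji; apply: contrapT => /imin.
by move: Di => /=; rewrite /D /=; have [?|?] := pselect (path_of x i);
  have [?|?] := pselect (path_of y i); tauto.
Qed.

Lemma code_branch w :
    (forall k, (k < size w)%N -> letter (nth (0, set0, 0%R) w k)) ->
  is_branch (w, code w).
Proof.
move=> lw; split=> //=; first exact: wo_code.
by have /card_leTP[e _] := natL; exists (e 0).
Qed.

Lemma code1_branch s : letter s -> is_branch ([:: s], code [:: s]).
Proof. by move=> ls; apply: code_branch => -[]. Qed.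

Definition branch1 s (ls : letter s) : branch := exist _ _ (code1_branch ls).

Lemma letter1 n a : letter (n, a, 1%R).
Proof. by rewrite /letter /=; exact/eqP/oner_neq0. Qed.

Lemma letter2 n a : letter (n, a, 2%R).
Proof. by rewrite /letter /=; lra. Qed.

Arguments letter1 n a : clear implicits.
Arguments letter2 n a : clear implicits.

(** The rationals 1 and 2 tag the two summands. The free natural number, the leading coordinate of a
    symbol, makes each fibre cofinal. *)
Definition branch_fibre (t : L + branch_order) (c : branch_order) : Prop :=
  match t with
  | inl l => exists n, c = branch1 (letter1 n [set l])
  | inr x => exists n, c = branch1 (letter2 n (path_of x))
  end.

(** With two values left for the rational, the order of symbols is a lexicographic product of
    well-orders. *)
Lemma sym_min (A : set symbol) : (forall s, A s -> s.2 = 1%R \/ s.2 = 2%R) ->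
  A !=set0 -> exists2 m, A m & forall s, A s -> ~ sym_lt s m.
Proof.
move=> A12 [[[n0 a0] q0] As0].
have exn : exists n, `[< exists a q, A (n, a, q) >].
  by exists n0; apply/asboolP; exists a0, q0.
case: (ex_minnP exn) => n /asboolP[a1 [q1 A1]] nmin.
have [|a [q Aq] amin] := @wo_min pow_wo [set a | exists q, A (n, a, q)].
  by exists a1, q1.
have [r Ar rmin] : exists2 r, A (n, a, r) & forall r', A (n, a, r') -> ~ (r' < r)%R.
  have [A1'|A1'] := pselect (A (n, a, 1%R)).
    by exists 1%R => // r' /A12 /= [] ->; lra.
  by exists q => // r' Ar'; have /= [rE|->] := A12 _ Ar';
    have /= [qE|->] := A12 _ Aq; rewrite ?rE ?qE in Ar' Aq *; try lra.
exists (n, a, r) => // -[[n' a'] r'] As'; rewrite /sym_lt /=.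
case=> [n'n|[n'n [a'a|[a'a r'r]]]].
- suff : (n <= n')%N by rewrite leqNgt n'n.
  by apply: nmin; apply/asboolP; exists a', r'.
- by move: a'a => /negP; apply; apply: amin; exists r'; rewrite /= -n'n.
- by move: As'; rewrite n'n a'a => /rmin.
Qed.

Lemma branch_fibre_cofinal : cofinal_fibres branch_fibre.
Proof.
split.
- move=> s t c; case: s => [l|x] [n ->]; case: t => [l'|x'] [n' /(congr1 sval)[]] //.
  + by move=> _ ll' _; congr inl; exact: set1_inj ll'.
  + by move=> _ xx' _; congr inr; exact: path_inj xx'.
- move=> t i; have below s (ls : letter s) :
      ((symb i 0).1.1 < s.1.1)%N -> branch_lt i (branch1 ls).
    by move=> lt; exists 0 => //; left.
  case: t => [l|x].
    exists (branch1 (letter1 (symb i 0).1.1.+1 [set l])); last by eexists.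
    exact: below.
  exists (branch1 (letter2 (symb i 0).1.1.+1 (path_of x))); last by eexists.
  exact: below.
- have one c : (exists t, branch_fibre t c) -> exists2 ls : letter (symb c 0),
      c = branch1 ls & (symb c 0).2 = 1%R \/ (symb c 0).2 = 2%R.
    case=> -[l|x] [n ->] /=; first by exists (letter1 n [set l]); [|left].
    by exists (letter2 n (path_of x)); [|right].
  move=> B Bf [b Bb].
  have [_ [c Bc <-] cmin] :
      exists2 m, ((fun c => symb c 0) @` B) m &
        forall s, ((fun c => symb c 0) @` B) s -> ~ sym_lt s m.
    apply: sym_min; last by exists (symb b 0), b.
    by move=> _ [c /Bf/one[_ _ h12] <-].
  exists c => // x Bx [k low xc].
  have [ls ce _] := one _ (Bf _ Bc); have [ls' xe _] := one _ (Bf _ Bx).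
  case: k low xc => [_ xc|k low xc]; first by apply: cmin xc; exists x.
  suff xcE : x = c by move: xc; rewrite xcE => /sym_irr.
  apply: path_inj; rewrite xe ce /path_of /=.
  by have -> : symb x 0 = symb c 0 by exact: low.
Qed.

Lemma branch_order_spec : branches_over L branch_order.
Proof.
split; first exact: branch_linear.
exists path_of; split.
- exact: branch_splits.
- move=> x i u v uv; have [w lw wP] := word_between uv.
  have [irr tr tot] := linL.
  (* The ball prescribes the branch up to and including [i], the interval prescribes the word, and
     the code of the word is needed only above [i]: the two demands do not meet. *)
  pose S := [set j | [\/ rlt j i /\ path_of x j, j = i /\ ~ path_of x i |
                        rlt i j /\ code w j]].
  have bS : is_branch (w, S).
    split=> //=; last first.
      exists i => j ij; split=> [[[ji _]|[ji _]|[]]//|]; last by constructor 3.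
        by case: (irr i); apply: tr ji.
      by case: (irr i); rewrite -{2}ji.
    have [_ wox _] := svalP x.
    have woU := wo_subsetU linL (wo_subsetU linL wox (@wo_subset1 L i linL)) (@wo_code w).
    by apply: wo_subsetS woU => j /= [[_ ?]|[-> _]|[_ ?]]; [left; left|left; right|right].
  pose y : branch := exist _ _ bS.
  have [uy yv] := wP y erefl; exists y; split=> //; split=> [j ji|].
    split=> [xj|[[]|[ij]|[ij]]//]; first by constructor 1.
      by case: (irr i); rewrite -{1}ij.
    by case: (irr i); apply: tr ji.
  split=> [xi [[ii _]|[_]|[ii _]]|nyi]; [exact: irr ii| by [] |exact: irr ii|].
  by apply: contrapT => xi; apply: nyi; constructor 2.
- exact: inhabits (branch1 (letter1 0 set0)).
- apply/card_leTP; exists (fun a => branch1 (letter1 0 a)) => a b.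
  by move=> /(congr1 sval)[].
- by exists branch_fibre; exact: branch_fibre_cofinal.
Qed.

End BranchOrder.

(** * The tower of levels *)

Section SumOrder.
Import Order.TTheory.

Variables (I : relType) (B : I -> relType).
Hypotheses (linI : strict_linear I) (linB : forall i, strict_linear (B i)).

Definition sum_lt (z z' : rat + {i & B i}) : Prop :=
  match z, z' with
  | inl q, inl r => (q < r)%R
  | inl _, inr _ => True
  | inr _, inl _ => False
  | inr (existT i x), inr (existT j y) =>
      rlt i j \/ exists e : i = j, rlt (ecast k (B k) e x) y
  end.

Definition sum_order := RelType sum_lt.

Lemma sum_lt_same i (x y : B i) :
  sum_lt (inr (existT _ i x)) (inr (existT _ i y)) <-> rlt x y.
Proof.
split=> [[|[e]]|xy]; last by right; exists erefl.
  by case: linI => irr _ _ /irr.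
by rewrite (Prop_irrelevance e erefl).
Qed.

Lemma sum_linear : strict_linear sum_order.
Proof.
have [irr tr tot] := linI; split.
- case=> [q /=|[i x] /sum_lt_same]; first by rewrite ltxx.
  by case: (linB i) => + _ _; apply.
- case=> [q|[i x]] [r|[j y]] [s|[k z]] //=; first exact: lt_trans.
  move=> [ij|[e xy]] [jk|[e' yz]].
  + by left; exact: tr jk.
  + by left; rewrite -e'.
  + by left; rewrite e.
  + subst j k; right; exists erefl; by case: (linB i) => _ trB _; exact: trB xy yz.
- case=> [q|[i x]] [r|[j y]] /=.
  + by have [?|?|->] := ltgtP q r; [constructor 2|constructor 3|constructor 1].
  + by constructor 2.
  + by constructor 3.
  + have [ij|ij|ij] := tot i j; last 2 first.
    * by constructor 2; left.
    * by constructor 3; left.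
    subst j; have [_ _ totB] := linB i; have [->|xy|yx] := totB x y.
    * by constructor 1.
    * by constructor 2; right; exists erefl.
    * by constructor 3; right; exists erefl.
Qed.

End SumOrder.

(** * Transfinite recursion on the levels *)

Section Levels.
Variable W : wellOrder.

Definition wo_rel (V : wellOrder) : relType := RelType (@wo_lt V).

Lemma wo_rel_linear (V : wellOrder) : strict_linear (wo_rel V).
Proof.
by split; [exact: wo_lt_irr|exact: wo_lt_trans|exact: wo_lt_total].
Qed.

(** The recursion defining [level] needs a total function, while a suitable next level is known to
    exist only by an induction on the levels already built; [L] is a dummy value. *)
Definition next_level (L : relType) : relType :=
  if pselect (exists X, branches_over L X) is left e then projT1 (cid e) else L.

Lemma next_levelP L : (exists X, branches_over L X) -> branches_over L (next_level L).
Proof. by rewrite /next_level; case: pselect => // e _; case: cid. Qed.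

Definition level : W -> relType :=
  Fix (@wo_lt_wf W) (fun=> relType)
    (fun a P => next_level (@sum_order (wo_rel (wo_seg a))
                              (fun b => P (sval b) (svalP b)))).

Definition lower (a : W) : relType :=
  @sum_order (wo_rel (wo_seg a)) (fun b => level (sval b)).

Lemma levelE a : level a = next_level (lower a).
Proof.
rewrite {1}/level Fix_eq // => x f g fg; congr next_level; congr sum_order.
by apply/funext => b; exact: fg.
Qed.

Lemma nat_lower a : [set: nat] #<= [set: lower a].
Proof.
apply/card_leTP; exists (fun n => inl (n%:R)%R) => m n [] /eqP.
by rewrite Num.Theory.eqr_nat => /eqP.
Qed.

Definition sum_to_lower (a b : W) (ba : wo_lt b a) (z : lower b + level b) :
    lower a :=
  match z with
  | inl (inl q) => inl q
  | inl (inr (existT c x)) =>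
      inr (existT (fun c : wo_seg a => level (sval c))
                  (exist _ (sval c) (wo_lt_trans (svalP c) ba)) x)
  | inr x => inr (existT (fun c : wo_seg a => level (sval c)) (exist _ b ba) x)
  end.

Lemma existT_seg (a b : W) (p q : wo_lt b a) (x : level b) :
  existT (fun c : wo_seg a => level (sval c)) (exist _ b p) x =
  existT (fun c : wo_seg a => level (sval c)) (exist _ b q) x.
Proof. by rewrite (Prop_irrelevance p q). Qed.

Section LowerFibres.
Variables (a : W) (K : forall b, lower b + level b -> level b -> Prop).
Hypothesis fibK : forall b, wo_lt b a -> cofinal_fibres (@K b).
Hypothesis linP : forall b, wo_lt b a -> strict_linear (level b).
Hypothesis inhP : forall b, wo_lt b a -> inhabited (level b).

(** Points of level [b] decode to elements of level [b] or below, so an element is coded anew in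
    each level from its own upwards; this keeps its codes cofinal at limit stages too. Among the
    rationals only natural numbers are codes, which keeps the domain well-ordered, and the second
    component of the unpickled pair gives each rational infinitely many of them. *)
Definition lower_fibre (l c : lower a) : Prop :=
  match c with
  | inl q => exists n : nat, q = (n%:R)%R /\
      l = inl (odflt 0%R (omap fst (unpickle n : option (rat * nat))))
  | inr (existT b c') => exists2 z, sum_to_lower (svalP b) z = l & K z c'
  end.

Lemma lower_linear : strict_linear (lower a).
Proof.
apply: sum_linear; first exact: wo_rel_linear.
by move=> [b ba]; exact: linP.
Qed.

Lemma lower_fibre_level (l i : lower a) (b : wo_seg a) :
    (exists z, sum_to_lower (svalP b) z = l) ->
    (if i is inr v then projT1 v = b \/ wo_lt (projT1 v) b else True) ->
  exists2 c, rlt i c & lower_fibre l c.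
Proof.
move=> [z zl] ib; have ba := svalP b; have [_ Kcof _] := fibK ba.
pose B (c : wo_seg a) := level (sval c).
have above x : rlt i (inr (existT B b x) : lower a) ->
    exists2 c, rlt i c & lower_fibre l c.
  move=> ix; have [c xc Kzc] := Kcof z x.
  exists (inr (existT B b c)); last by exists z.
  have [_ tr _] := lower_linear; apply: tr ix _.
  exact/(sum_lt_same (wo_rel_linear (wo_seg a))).
have [x0] := inhP ba; case: i ib above => [q|[c y]] ib above.
  exact: (above x0).
have /= [cb|cb] := ib; last by apply: (above x0); left.
subst c; have [y' yy' Kzy'] := Kcof z y.
exists (inr (existT B b y')); last by exists z.
exact/(sum_lt_same (wo_rel_linear (wo_seg a))).
Qed.

Lemma lower_fibre_cofinal : cofinal_fibres lower_fibre.
Proof.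
split.
- move=> s t [q|[b c]] /=.
    by move=> [n [-> ->]] [m [/eqP]]; rewrite Num.Theory.eqr_nat => /eqP -> ->.
  move=> [z <- Kzc] [z' <- Kz'c]; have [Kfun _ _] := fibK (svalP b).
  by rewrite (Kfun _ _ _ Kzc Kz'c).
- move=> l i.
  have [[q qi]|ni] := pselect (exists q, i = inl q); last first.
    case: i ni => [q ni|[b y] _]; first by case: ni; exists q.
    have [[r ->]|[c [x ->]]] : (exists r, l = inl r) \/ exists c x, l = inr (existT _ c x).
      by case: l => [r|[c x]]; [left; exists r|right; exists c, x].
      apply: (@lower_fibre_level _ _ b); first by exists (inl (inl r)).
      by left.
    (* A code of [l] above [i] is sought in the higher of the levels of [l] and [i]. *)
    have [cb|cb] := boolP (wo_le c b); last first.
      apply: (@lower_fibre_level _ _ c).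
        exists (inr x) => /=; congr inr.
        by case: c x {cb} => c ca x; exact: existT_seg.
      by right.
    apply: (@lower_fibre_level _ _ b); last by left.
    have [bc|bc] := boolP (wo_le b c); last first.
      exists (inl (inr (existT (fun c : wo_seg (sval b) => level (sval c))
                                (exist _ (sval c) bc) x))).
      by case: c x {cb} bc => c ca x bc /=; congr inr; exact: existT_seg.
    have cbE : c = b by exact: wo_le_anti.
    subst c; exists (inr x) => /=; congr inr.
    by case: b x {y cb bc} => b ba x; exact: existT_seg.
  subst i; case: l => [r|[c x]]; last first.
    apply: (@lower_fibre_level _ _ c) => [|//].
    exists (inr x) => /=; congr inr.
    by case: c x => c ca x; exact: existT_seg.
  have [n qn] : exists n : nat, (q < n%:R)%R.
    exists (Num.truncn `|q|%R).+1.
    by apply: Order.POrderTheory.le_lt_trans (Num.Theory.ler_norm q) _;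
       exact: Num.Theory.truncnS_gt.
  pose f (k : nat) := pickle (r, k).
  have finj : injective f by move=> k m /(pcan_inj pickleK)[].
  have [k nk] : exists k, (n <= f k)%N.
    apply: contrapT => nk.
    have lt (k : 'I_n.+1) : (f k < n)%N.
      by rewrite ltnNge; apply/negP => nfk; apply: nk; exists k.
    pose g k := Ordinal (lt k).
    have ginj : injective g by move=> k m [] /finj/val_inj.
    by have := leq_card _ ginj; rewrite !card_ord ltnn.
  exists (inl (f k)%:R)%R => /=.
    by apply: Order.POrderTheory.lt_le_trans qn _; rewrite Num.Theory.ler_nat.
  by exists (f k); rewrite /f pickleK.
- move=> A AK [m Am].
  have [[q Aq]|nq] := pselect (exists q, A (inl q)).
    have exn : exists n : nat, `[< A (inl (n%:R)%R) >].
      have [t [n [qn _]]] := AK _ Aq.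
      by exists n; apply/asboolP; rewrite -qn.
    case: (ex_minnP exn) => n /asboolP An nmin.
    exists (inl (n%:R)%R) => // -[r Ar|[b c] Az]; last by case.
    have [t [k [rk _]]] := AK _ Ar; rewrite rk /= Num.Theory.ltr_nat.
    move=> kn; have /asboolP/nmin : A (inl (k%:R)%R) by rewrite -rk.
    by rewrite leqNgt kn.
  pose B (c : wo_seg a) := level (sval c).
  have [|b [c0 Abc] bmin] := @wo_min (wo_seg a) [set b | exists c, A (inr (existT B b c))].
    by case: m Am => [q Aq|[b c] Ac]; [case: nq; exists q|exists b, c].
  have ba := svalP b; have [_ _ woK] := fibK ba.
  have [| |c Ac cmin] := woK [set c | A (inr (existT B b c))].
  - by move=> c /= /AK[t [z _ Kzc]]; exists z.
  - by exists c0.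
  exists (inr (existT B b c)) => // -[q Aq|[d x] Ax] /=.
    by case: nq; exists q.
  case=> [db|[e xc]].
    by move: db => /negP; apply; apply: bmin; exists x.
  by subst d; exact: cmin xc.
Qed.

End LowerFibres.

Lemma level_spec a : branches_over (lower a) (level a).
Proof.
elim/(well_founded_ind (@wo_lt_wf W)): a => a IH.
rewrite [X in branches_over _ X]levelE; apply: next_levelP.
have hK b : exists K : lower b + level b -> level b -> Prop,
    wo_lt b a -> cofinal_fibres K.
  have [ba|nba] := pselect (wo_lt b a); last by exists (fun _ _ => False).
  by have [_ [S [_ _ _ _ [K fK]]]] := IH _ ba; exists K.
pose K b := projT1 (cid (hK b)).
have fK b : wo_lt b a -> cofinal_fibres (K b) by rewrite /K; case: cid.
have linP b : wo_lt b a -> strict_linear (level b) by move=> /IH[].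
have inhP b : wo_lt b a -> inhabited (level b) by move=> /IH[_ [S []]].
eexists; apply: branch_order_spec.
- exact: lower_linear.
- exact: (lower_fibre_cofinal fK linP inhP).
- exact: nat_lower.
Qed.

End Levels.

(** * Abstract towers *)

Definition lev_lt (W : wellOrder) (a b : option W) : Prop :=
  match a, b with
  | Some x, Some y => wo_lt x y
  | None, Some _ => True
  | _, None => False
  end.

(** Words, codes and cardinalities are forgotten here: dependence and the upper bound hold for every
    such structure. The level [None] consists of the named rationals. *)
Record tower (W : wellOrder) := Tower {
  tower_order :> relType;
  lev : tower_order -> option W;
  branch_of : tower_order -> set tower_order;
  base : rat -> tower_order;
  tower_linear : strict_linear tower_order;
  base_inj : injective base;
  lev_base : forall x, lev x = None <-> exists q, x = base q;
  lev_lt_rlt : forall x y, lev_lt (lev x) (lev y) -> rlt x y;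
  lev_inh : forall a, exists x, lev x = a;
  tower_splits : forall x y, x <> y -> lev x = lev y -> lev x <> None ->
    exists2 i, lev_lt (lev i) (lev x) & splits_at (branch_of x) (branch_of y) i;
  tower_dense : forall a u v, ltO u v ->
    (forall x, u = Some x -> lev x = a) -> (forall x, v = Some x -> lev x = a) ->
    exists y, [/\ lev y = a, ltO u (Some y) & ltO (Some y) v];
  tower_split_dense : forall x i u v, ltO u v -> lev_lt (lev i) (lev x) ->
    (forall y, u = Some y -> lev y = lev x) -> (forall y, v = Some y -> lev y = lev x) ->
    exists y, [/\ lev y = lev x, ltO u (Some y), ltO (Some y) v
                & splits_at (branch_of x) (branch_of y) i] }.

(** * Existence of a tower and its cardinality *)

Section TowerExists.
Variable W : wellOrder.

Definition tower_rel : relType := @sum_order (wo_rel W) (@level W).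

Definition lower_in (a : W) (l : lower a) : tower_rel :=
  match l with
  | inl q => inl q
  | inr (existT b x) => inr (existT (@level W) (sval b) x)
  end.

Definition tower_lev (x : tower_rel) : option W :=
  if x is inr (existT a _) then Some a else None.

Definition level_path (a : W) : level a -> set (lower a) :=
  projT1 (cid (level_spec a).2).

Lemma level_pathP a :
  [/\ forall x y, x <> y -> exists i, splits_at (level_path (a := a) x) (level_path y) i,
      forall x i u v, ltO u v -> exists y,
        [/\ ltO u (Some y), ltO (Some y) v & splits_at (level_path (a := a) x) (level_path y) i],
      inhabited (level a),
      [set: set (lower a)] #<= [set: level a]
    & exists K : lower a + level a -> level a -> Prop, cofinal_fibres K].
Proof. by rewrite /level_path; case: cid. Qed.

Definition tower_path (x : tower_rel) : set tower_rel :=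
  if x is inr (existT a y) then lower_in (a := a) @` level_path y else set0.

Lemma tower_rel_linear : strict_linear tower_rel.
Proof.
apply: sum_linear; first exact: wo_rel_linear.
by move=> a; have [] := level_spec a.
Qed.

Lemma lower_in_lt a (l m : lower a) : rlt l m <-> rlt (lower_in l) (lower_in m).
Proof.
case: l m => [q|[b x]] [r|[c y]] //=; split=> -[bc|[e xy]]; try by left.
  by subst c; right; exists erefl.
right; case: b c e x y xy => [b ba] [c ca] /= e; subst c.
by rewrite (Prop_irrelevance ba ca) => x y xy; exists erefl.
Qed.

Lemma lower_in_inj a : injective (@lower_in a).
Proof.
have [irr _ _] := tower_rel_linear.
have lin : strict_linear (lower a).
  apply: sum_linear; first exact: wo_rel_linear.
  by move=> b; have [] := level_spec (sval b).
move=> l m lm; have [_ _ tot] := lin.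
have [//|/lower_in_lt|/lower_in_lt] := tot l m; rewrite lm => /irr //.
Qed.

Lemma lower_inP a (x : tower_rel) :
  lev_lt (tower_lev x) (Some a) <-> exists l : lower a, lower_in l = x.
Proof.
split=> [|[[q|[b y]] <-//=]]; last exact: svalP b.
case: x => [q _|[b y] /= ba]; first by exists (inl q).
by exists (inr (existT (fun b : wo_seg a => level (sval b)) (exist _ b ba) y)).
Qed.

Lemma splits_lower a (A B : set (lower a)) i :
  splits_at A B i ->
  splits_at (lower_in (a := a) @` A) (lower_in (a := a) @` B) (lower_in i).
Proof.
have im (C : set (lower a)) j : (lower_in (a := a) @` C) (lower_in j) <-> C j.
  by split=> [[k Ck /lower_in_inj <-]|Cj]; [|exists j].
move=> [low at_i]; split=> [j ji|]; last by rewrite !im.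
have /lower_inP[k kj] : lev_lt (tower_lev j) (Some a).
  have: lev_lt (tower_lev (lower_in i)) (Some a) by apply/lower_inP; exists i.
  case: (lower_in i) j ji => [q|[b x]] [r|[c y]] //= -[cb|[e _]]; last by subst c.
  exact: wo_lt_trans.
by subst j; rewrite !im; apply: low; apply/lower_in_lt.
Qed.

Definition in_level a (x : level a) : tower_rel := inr (existT (@level W) a x).

Lemma ltO_level a (u v : option (level a)) :
  ltO u v <-> ltO (omap (@in_level a) u) (omap (@in_level a) v).
Proof.
case: u v => [x|] [y|] //=; apply: iff_sym.
by apply: (@sum_lt_same (wo_rel W)); exact: wo_rel_linear.
Qed.

Lemma option_in_level a (u : option tower_rel) :
    (forall x, u = Some x -> tower_lev x = Some a) ->
  exists u', u = omap (@in_level a) u'.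
Proof.
case: u => [[q|[b x]]|] h; last by exists None.
  by have := h _ erefl.
by have [ba] := h _ erefl; subst b; exists (Some x).
Qed.

Lemma tower_split_dense_subproof (x i : tower_rel) u v :
    ltO u v -> lev_lt (tower_lev i) (tower_lev x) ->
    (forall y, u = Some y -> tower_lev y = tower_lev x) ->
    (forall y, v = Some y -> tower_lev y = tower_lev x) ->
  exists y, [/\ tower_lev y = tower_lev x, ltO u (Some y), ltO (Some y) v
              & splits_at (tower_path x) (tower_path y) i].
Proof.
case: x => [q|[a x]]; first by case: (tower_lev i).
move=> uv /lower_inP[l <-] /option_in_level[u' uE] /option_in_level[v' vE].
subst u v; move: uv => /(ltO_level u' v').2 uv; have [_ dense _ _ _] := level_pathP a.
have [y [uy yv xy]] := dense x l u' v' uv.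
exists (inr (existT _ a y)); split=> //.
- exact: (ltO_level u' (Some y)).1.
- exact: (ltO_level (Some y) v').1.
- exact: splits_lower.
Qed.

Lemma tower_dense_subproof (a : option W) (u v : option tower_rel) :
    ltO u v ->
    (forall x, u = Some x -> tower_lev x = a) ->
    (forall x, v = Some x -> tower_lev x = a) ->
  exists y, [/\ tower_lev y = a, ltO u (Some y) & ltO (Some y) v].
Proof.
case: a => [a|] uv ua va.
  have [_ _ [x0] _ _] := level_pathP a.
  have [y [? ? ? _]] := @tower_split_dense_subproof
    (inr (existT _ a x0)) (inl 0%R) u v uv I ua va.
  by exists y.
case: u v uv ua va => [[q|[a x]]|] [[r|[b y]]|] //= uv ua va;
  try (by have := ua _ erefl); try (by have := va _ erefl).
- by exists (inl ((q + r) / 2)%R); split=> //=; lra.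
- by exists (inl (q + 1)%R); split=> //=; lra.
- by exists (inl (r - 1)%R); split=> //=; lra.
- by exists (inl 0%R).
Qed.

Definition the_tower : tower W.
Proof.
refine (@Tower W tower_rel tower_lev tower_path inl tower_rel_linear _ _ _ _ _ _ _).
- by move=> q r [].
- case=> [q|[a x]] /=; first by split=> // _; exists q.
  by split=> // -[].
- by case=> [q|[a x]] [r|[b y]] //= ab; left.
- case=> [a|]; last by exists (inl 0%R).
  by have [_ _ [x] _ _] := level_pathP a; exists (inr (existT _ a x)).
- case=> [q|[a x]] [r|[b y]] //= xy [ab] _; subst b.
  have [sp _ _ _ _] := level_pathP a.
  have [xyE|i xyi] := sp x y; first by apply: xy; rewrite xyE.
  exists (lower_in i); last exact: splits_lower.
  by apply/lower_inP; exists i.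
- exact: tower_dense_subproof.
- exact: tower_split_dense_subproof.
Defined.

(** The power set in the hypothesis pays for the successor case, the disjoint sum for the limit case
    and [rat] for zero. *)
Lemma beth_step_le_sum (I : Type) (lt : I -> I -> Prop) (B P : I -> Type) :
    (forall i, [set: set (B i)] #<= [set: P i]) ->
  [set: beth_step lt B] #<= [set: rat + {i & P i}].
Proof.
move=> BP; rewrite /beth_step.
have inr_inj : injective (@inr rat {i & P i}) by move=> ? ? [].
have inI i : [set: P i] #<= [set: rat + {i & P i}].
  apply/card_leTP; exists (fun x => inr (existT _ i x)) => x y /inr_inj e.
  by have := projT2_eq e; rewrite (Prop_irrelevance (projT1_eq e) erefl).
case: pselect => [_|_]; last first.
  by apply/card_leTP; exists (fun n => inl (n%:R)%R) => m n [] /eqP;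
     rewrite Num.Theory.eqr_nat => /eqP.
case: pselect => [hm|_]; first exact: card_le_trans (BP _) (inI _).
have BP' i : [set: B i] #<= [set: P i] by exact: card_le_trans (card_le_powerset _) (BP i).
pose F i := projT1 (cid ((card_leTP _ _).1 (BP' i))).
have Finj i : injective (F i) by rewrite /F; case: cid.
apply/card_leTP; exists (fun x => inr (existT _ (projT1 x) (F _ (projT2 x)))).
move=> [i x] [j y] /= /inr_inj e; have ij : i = j by exact: (congr1 (@projT1 _ _) e).
subst j; congr existT; apply: Finj.
by have := projT2_eq e; rewrite (Prop_irrelevance (projT1_eq e) erefl).
Qed.

Lemma beth_at_le_level (a : W) : [set: set (beth_at a)] #<= [set: level a].
Proof.
elim/(well_founded_ind (@wo_lt_wf W)): a => a IH.
have [_ _ _ le _] := level_pathP a; apply: card_le_trans le.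
apply: card_le_set; rewrite beth_atE; apply: beth_step_le_sum => b.
exact: IH (svalP b).
Qed.

Lemma beth_le_tower : [set: beth W] #<= [set: the_tower].
Proof. by apply: beth_step_le_sum => a; exact: beth_at_le_level. Qed.

End TowerExists.

(** * Back-and-forth in finite reducts *)

Lemma finite_max (L : relType) (n : nat) (f : nat -> L) (T : nat -> Prop) :
    strict_linear L ->
  (forall j, (j < n)%N -> ~ T j) \/
  exists j, [/\ (j < n)%N, T j &
    forall k, (k < n)%N -> T k -> f k = f j \/ rlt (f k) (f j)].
Proof.
move=> [irr tr tot]; elim: n => [|n IH]; first by left.
have [Tn|nTn] := pselect (T n); last first.
  case: IH => [nT|[j [jn Tj jmax]]]; [left|right; exists j; split=> //].
  - by move=> j; rewrite ltnS leq_eqVlt => /orP[/eqP ->//|/nT].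
  - exact: ltnW.
  - by move=> k; rewrite ltnS leq_eqVlt => /orP[/eqP ->//|/jmax].
right; case: IH => [nT|[j [jn Tj jmax]]].
  exists n; split=> // k; rewrite ltnS leq_eqVlt => /orP[/eqP ->|/nT//].
  by left.
have [jn'|jn'] := pselect (rlt (f j) (f n)).
  exists n; split=> // k; rewrite ltnS leq_eqVlt => /orP[/eqP ->|/jmax h /h].
    by left.
  by move=> [->|kj]; right=> //; exact: tr kj jn'.
exists j; split=> //; first exact: ltnW.
move=> k; rewrite ltnS leq_eqVlt => /orP[/eqP -> _|/jmax//].
by have [->|//|] := tot (f n) (f j); [left|right|].
Qed.

Lemma finite_min (L : relType) (n : nat) (f : nat -> L) (T : nat -> Prop) :
    strict_linear L ->
  (forall j, (j < n)%N -> ~ T j) \/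
  exists j, [/\ (j < n)%N, T j &
    forall k, (k < n)%N -> T k -> f k = f j \/ rlt (f j) (f k)].
Proof.
move=> [irr tr tot]; apply: (@finite_max (RelType (fun x y : L => rlt y x))).
split=> // [x y z yx zy|x y]; first exact: tr zy yx.
by have [->|?|?] := tot x y; [constructor 1|constructor 3|constructor 2].
Qed.

(** * First differences in a binary tree *)

Section Diff.
Variables (W : wellOrder) (M : tower W).
Implicit Types (x y z : M).

Let linM := tower_linear M.
Let irrM : forall x, ~ rlt x x. Proof. by case: linM. Qed.
Let trM : forall x y z, rlt x y -> rlt y z -> rlt x z. Proof. by case: linM. Qed.
Let totM : forall x y, [\/ x = y, rlt x y | rlt y x]. Proof. by case: linM. Qed.

Lemma lev_lt_irr (a : option W) : ~ lev_lt a a.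
Proof. by case: a => //= a; exact: wo_lt_irr. Qed.

Lemma lev_lt_trans (a b c : option W) : lev_lt a b -> lev_lt b c -> lev_lt a c.
Proof. by case: a b c => [a|] [b|] [c|] //=; exact: wo_lt_trans. Qed.

Lemma lev_lt_total (a b : option W) : [\/ a = b, lev_lt a b | lev_lt b a].
Proof.
case: a b => [a|] [b|] /=; [|by constructor 3|by constructor 2|by constructor 1].
by have [->|?|?] := wo_lt_total a b; [constructor 1|constructor 2|constructor 3].
Qed.

Lemma rlt_lev x y : rlt x y -> lev x = lev y \/ lev_lt (lev x) (lev y).
Proof.
move=> xy; have [->|?|/lev_lt_rlt yx] := lev_lt_total (lev x) (lev y).
- by left.
- by right.
- by case: (@irrM x); exact: trM xy yx.
Qed.

Definition diff x y (i : M) :=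
  [/\ lev x = lev y, lev_lt (lev i) (lev x) & splits_at (branch_of x) (branch_of y) i].

Lemma diff_irr x i : ~ diff x x i.
Proof. by case=> _ _ [_]; tauto. Qed.

Lemma diff_sym x y i : diff x y i -> diff y x i.
Proof.
move=> [xy ix [low at_i]]; split; [by []|by rewrite -xy|split].
  by move=> j /low; tauto.
by have [?|?] := pselect (branch_of x i); have [?|?] := pselect (branch_of y i); tauto.
Qed.

Lemma diff_uniq x y i j : diff x y i -> diff x y j -> i = j.
Proof.
move=> [_ _ [lowi at_i]] [_ _ [lowj at_j]].
have [//|ij|ji] := totM i j; first by have := lowj _ ij; tauto.
by have := lowi _ ji; tauto.
Qed.

Lemma diff_trans_lt x y z i j : diff x y i -> diff y z j -> rlt i j -> diff x z i.
Proof.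
move=> [xy ix [lowi at_i]] [yz _ [lowj at_j]] ij.
split=> //; first by rewrite xy.
split; last by have := lowj _ ij; tauto.
by move=> k ki; have := lowi _ ki; have := lowj _ (trM ki ij); tauto.
Qed.

Lemma diff_trans_gt x y z i j : diff x y i -> diff y z j -> rlt j i -> diff x z j.
Proof.
move=> xy yz ji; apply: diff_sym.
exact: diff_trans_lt (diff_sym yz) (diff_sym xy) ji.
Qed.

(** Binary branching: two elements that leave [y] at [i] go to the same side there, so they can only
    split later. *)
Lemma diff_trans_eq x y z i k : diff x y i -> diff y z i -> diff x z k -> rlt i k.
Proof.
move=> [xy ix [lowi at_i]] [yz _ [lowj at_j]] [_ _ [lowk at_k]].
have [ik|//|ki] := totM i k.
  by subst k; have [?|?] := pselect (branch_of x i);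
    have [?|?] := pselect (branch_of y i); tauto.
by have := lowi _ ki; have := lowj _ ki; tauto.
Qed.

(** Binary branching again: three changes of side at [i] amount to one. *)
Lemma diff_path3 x y z t i : diff x y i -> diff y z i -> diff z t i -> diff x t i.
Proof.
move=> [xy ix [lowi at_i]] [yz _ [lowj at_j]] [zt _ [lowk at_k]].
split=> //; [by rewrite xy yz|split].
  by move=> j ji; have := lowi _ ji; have := lowj _ ji; have := lowk _ ji; tauto.
by have [?|?] := pselect (branch_of x i); have [?|?] := pselect (branch_of y i);
   have [?|?] := pselect (branch_of z i); tauto.
Qed.

Lemma diff_ex x y : x <> y -> lev x = lev y -> lev x <> None ->
  exists i, diff x y i.
Proof.
by move=> xy lxy lx; have [i ix sp] := tower_splits xy lxy lx; exists i.
Qed.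

(** When [a] leaves [x] as late as possible, the splitting of [x] from any [a'] is visible between
    [a] and [a']; so [a] and [i] describe the position of [x] in the tree. The case of [c] equal to
    [i] cannot occur: [a'] would leave [x] later than [a]. *)
Lemma diff_nearest x a a' i l :
    diff x a i -> (forall i', diff x a' i' -> i' = i \/ rlt i' i) -> lev a' = lev x ->
  diff x a' l <-> (a' = a /\ l = i) \/
    exists2 c, diff a a' c & (rlt c i /\ l = c) \/ (rlt i c /\ l = i).
Proof.
move=> xa near la'; split=> [xa'|].
  have [a'a|naa'] := pselect (a' = a).
    by left; split=> //; subst a'; exact: diff_uniq xa' xa.
  right; have [xla ix _] := xa.
  have [|||c aa'] := @diff_ex a a'; first by move=> e; apply: naa'.
  - by rewrite la' xla.
  - by rewrite -xla => lx0; move: ix; rewrite lx0; case: (lev i).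
  exists c => //; have [ci|ci|ic] := totM c i.
  - subst c; have il := diff_trans_eq xa aa' xa'.
    have [li|li] := near _ xa'; first by case: (@irrM i); rewrite -{2}li.
    by case: (@irrM i); exact: trM il li.
  - by left; split=> //; exact: diff_uniq xa' (diff_trans_gt xa aa' ci).
  - by right; split=> //; exact: diff_uniq xa' (diff_trans_lt xa aa' ic).
move=> [[-> -> //]|[c aa' [[ci ->]|[ic ->]]]].
  exact: diff_trans_gt xa aa' ci.
exact: diff_trans_lt xa aa' ic.
Qed.

End Diff.

(** [lvl 0], ..., [lvl (r - 1)] are the levels occurring in a finite
    sublanguage. A partial isomorphism of the corresponding reduct is given by
    two enumerated subsets [A] and [B] that satisfy [iso]. *)
Section BackAndForth.
Variables (W : wellOrder) (M : tower W) (r : nat) (lvl : nat -> option W) (x0 : M).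
Hypothesis lvl_some : forall k, (k < r)%N -> lvl k <> None.
Implicit Types (x y z : M) (A B : seq M).

Let linM := tower_linear M.
Let irrM : forall x, ~ rlt x x. Proof. by case: linM. Qed.
Let trM : forall x y z, rlt x y -> rlt y z -> rlt x z. Proof. by case: linM. Qed.
Let totM : forall x y, [\/ x = y, rlt x y | rlt y x]. Proof. by case: linM. Qed.

Local Notation "A `_ j" := (nth x0 A j).

Definition visible x := exists2 k, (k < r)%N & lev x = lvl k.

(** Once all first differences are in [A], [diff_nearest] expresses the tree relations of a new
    point by indices into [A], which can be transported to an isomorphic copy. *)
Definition closed A := forall j k, (j < size A)%N -> (k < size A)%N ->
  visible A`_j -> lev A`_j = lev A`_k -> A`_j <> A`_k ->
  exists2 l, (l < size A)%N & diff A`_j A`_k A`_l.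

Definition iso A B := [/\ size A = size B,
  forall j k, (j < size A)%N -> (k < size A)%N -> rlt A`_j A`_k <-> rlt B`_j B`_k,
  forall j k, (j < size A)%N -> (k < r)%N ->
    lev A`_j = lvl k <-> lev B`_j = lvl k
  & forall j k l, (j < size A)%N -> (k < size A)%N -> (l < size A)%N ->
    visible A`_j -> diff A`_j A`_k A`_l <-> diff B`_j B`_k B`_l].

Lemma iso_refl A : iso A A.
Proof. by split. Qed.

Lemma iso_visible A B j : iso A B -> (j < size A)%N -> visible A`_j <-> visible B`_j.
Proof.
by move=> [_ _ st _] jA; split=> -[k kr /(st _ _ jA kr) lk]; exists k.
Qed.

Lemma iso_sym A B : iso A B -> iso B A.
Proof.
move=> AB; have [sz lt st df] := AB; split; rewrite -?sz //.
- by move=> j k jA kA; apply: iff_sym; exact: lt.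
- by move=> j k jA kA; apply: iff_sym; exact: st.
- move=> j k l jA kA lA vB; apply: iff_sym; apply: df => //.
  exact/(iso_visible AB).
Qed.

Lemma iso_eq A B j k : iso A B -> (j < size A)%N -> (k < size A)%N ->
  A`_j = A`_k -> B`_j = B`_k.
Proof.
move=> [sz lt _ _] jA kA jk; have [//|/lt|/lt] := totM B`_j B`_k; rewrite jk.
  by move=> /(_ jA kA)/irrM.
by move=> /(_ kA jA)/irrM.
Qed.

Lemma iso_closed A B : iso A B -> closed A -> closed B.
Proof.
move=> AB clA j k; have [sz lt st df] := AB; rewrite -sz => jA kA.
move=> /(iso_visible AB jA) vj ljk njk.
have ljkA : lev A`_j = lev A`_k.
  by have [m mr lm] := vj; rewrite lm; apply/esym/st => //; rewrite -ljk; apply/st.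
have [|l lA /df D] := clA j k jA kA vj ljkA; first by move=> /(iso_eq AB jA kA).
by exists l; rewrite -?sz //; exact: D.
Qed.

Definition notin A x := forall j, (j < size A)%N -> A`_j <> x.

(** [A`_c] is the predecessor of [x] in [A]; there is none when [c = size A]. *)
Definition cut A x c := forall j, (j < size A)%N ->
  rlt A`_j x <-> (c < size A)%N /\ (A`_j = A`_c \/ rlt A`_j A`_c).

Lemma cut_ex A x : exists2 c, (c <= size A)%N & cut A x c.
Proof.
have [none|[c [cA cx cmax]]] :=
    finite_max (size A) (nth x0 A) (fun j => rlt A`_j x) linM.
  exists (size A) => // j jA; rewrite ltnn; split=> [/none//|[]//].
exists c; first exact: ltnW.
move=> j jA; split=> [jx|[_ [->//|jc]]]; last exact: trM cx.
by split=> //; exact: cmax.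
Qed.

Lemma cut_iso A B x y c : iso A B -> cut A x c -> cut B y c ->
  forall j, (j < size A)%N -> rlt A`_j x <-> rlt B`_j y.
Proof.
move=> AB cA cB j jA; have [sz lt _ _] := AB; have BA := iso_sym AB.
have jB : (j < size B)%N by rewrite -sz.
split=> [/cA|/cB] h.
  have [cs jc] := h jA; apply/cB; rewrite -?sz //; split=> //.
  by case: jc => [/(iso_eq AB jA cs)|/lt h']; [left|right; exact: h'].
have [cs jc] := h jB; apply/cA; rewrite ?sz //; split=> //.
by case: jc => [/(iso_eq BA jB cs)|h']; [left|right; apply/lt => //; rewrite sz].
Qed.

Lemma cut_transfer A B x y c : iso A B -> cut A x c ->
  (forall j, (j < size A)%N -> rlt A`_j x <-> rlt B`_j y) -> cut B y c.
Proof.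
move=> AB cA xy j; have [sz lt _ _] := AB; have BA := iso_sym AB.
rewrite -sz => jA; split=> [/(xy _ jA)/cA|[cs jc]].
  move=> /(_ jA)[cs [/(iso_eq AB jA cs)|/lt h]]; split=> //; first by left.
  by right; exact: h.
apply/(xy _ jA); apply/cA => //; split=> //.
case: jc => [e|?]; [left|right; exact/lt].
by apply: (iso_eq BA); rewrite -?sz.
Qed.

Lemma nth_last A x : (rcons A x)`_(size A) = x.
Proof. by rewrite nth_rcons ltnn eqxx. Qed.

Lemma nth_old A x j : (j < size A)%N -> (rcons A x)`_j = A`_j.
Proof. by rewrite nth_rcons => ->. Qed.

Lemma rcons_ind A x (Q : nat -> Prop) : Q (size A) ->
  (forall j, (j < size A)%N -> Q j) -> forall j, (j < size (rcons A x))%N -> Q j.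
Proof.
move=> Ql Qo j; rewrite size_rcons ltnS leq_eqVlt => /orP[/eqP ->//|]; exact: Qo.
Qed.

Lemma diff_notin A x j k : closed A -> notin A x -> (j < size A)%N ->
  (k < size A)%N -> visible A`_j -> ~ diff A`_j A`_k x.
Proof.
move=> clA nx jA kA vj D; have [ljk _ _] := D.
have [|l lA D'] := clA j k jA kA vj ljk.
  by move=> e; move: D; rewrite e => /diff_irr.
by apply: (nx l lA); exact: diff_uniq D' D.
Qed.

(** By closure [x] is not the first difference of two old points, so only the triples with [x] in
    one of the first two places need a hypothesis. *)
Lemma iso_rcons A B x y c : closed A -> iso A B -> notin A x -> notin B y ->
    cut A x c -> cut B y c ->
    (forall k, (k < r)%N -> lev x = lvl k <-> lev y = lvl k) ->
    (visible x -> forall j l, (j < size A)%N -> (l < size A)%N ->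
      diff x A`_j A`_l <-> diff y B`_j B`_l) ->
  iso (rcons A x) (rcons B y).
Proof.
move=> clA AB nx ny cx cy lxy dxy.
have clB := iso_closed AB clA; have [sz lt st df] := AB.
have oldB j : (j < size A)%N -> (rcons B y)`_j = B`_j by rewrite sz; exact: nth_old.
have lastB : (rcons B y)`_(size A) = y by rewrite sz nth_last.
have vxy : visible x <-> visible y.
  by split=> -[k kr lk]; exists k => //; exact/(lxy k kr).
have xylt := cut_iso AB cx cy.
split; first by rewrite !size_rcons sz.
- move=> j k jA kA; move: j jA k kA.
  apply: rcons_ind => [|j jA]; apply: rcons_ind => [|k kA].
  + by rewrite nth_last lastB; split=> /irrM.
  + rewrite nth_last lastB nth_old // oldB //.
    have [//|xk|kx] := totM x A`_k; first by move=> e; case: (nx k kA).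
      have [e|//|ky] := totM y B`_k; first by case: (ny k); rewrite -?sz.
      by move/(xylt k kA): ky => kx; case: (@irrM x); exact: trM xk kx.
    split=> [xk|yk]; first by case: (@irrM x); exact: trM xk kx.
    by move/(xylt k kA): kx => ky; case: (@irrM y); exact: trM yk ky.
  + by rewrite nth_last lastB nth_old // oldB //; exact: xylt.
  + by rewrite (nth_old _ jA) (nth_old _ kA) !oldB //; exact: lt.
- move=> j k jA; move: j jA k.
  apply: rcons_ind => [|j jA] k kr; first by rewrite nth_last lastB; exact: lxy.
  by rewrite nth_old // oldB //; exact: st.
- have self z t : ~ diff z t z by case=> _ /lev_lt_irr.
  have self' z t : ~ diff z t t by case=> -> /lev_lt_irr.
  move=> j k l jA kA lA; move: j jA k kA l lA.
  apply: rcons_ind => [|j jA]; apply: rcons_ind => [|k kA].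
  + by move=> l _ _; rewrite nth_last lastB; split=> /diff_irr.
  + apply: rcons_ind => [|l lA]; rewrite !nth_last ?lastB.
      by move=> _; split=> /self.
    by rewrite (nth_old _ kA) (nth_old _ lA) !oldB // => vx; exact: dxy.
  + apply: rcons_ind => [|l lA]; rewrite !nth_last ?lastB.
      by move=> _; split=> /self'.
    rewrite (nth_old _ jA) (nth_old _ lA) !oldB // => vj.
    have sym z t i : diff z t i <-> diff t z i by split=> /diff_sym.
    have [vx|nvx] := pselect (visible x); first by rewrite sym dxy // sym.
    split=> -[e _ _]; case: nvx; first by have [m mr lm] := vj; exists m; rewrite -?e.
    apply/vxy; have /(iso_visible AB jA)[m mr lm] := vj.
    by exists m; rewrite -?e.
  + rewrite (nth_old _ jA) (nth_old _ kA) (oldB j jA) (oldB k kA).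
    apply: rcons_ind => [|l lA]; rewrite ?nth_last ?lastB => vj.
      split=> [/(diff_notin clA nx jA kA vj)//|].
      move=> /(diff_notin clB ny) []; rewrite -?sz //.
      exact/(iso_visible AB).
    by rewrite (nth_old _ lA) oldB //; exact: df.
Qed.

Lemma closed_rcons A x : closed A ->
    (visible x -> forall j, (j < size A)%N -> lev A`_j = lev x -> A`_j <> x ->
      exists2 l, (l < size A)%N & diff x A`_j A`_l) ->
  closed (rcons A x).
Proof.
move=> clA dx.
have ok z t : (exists2 l, (l < size A)%N & diff z t A`_l) ->
    exists2 l, (l < size (rcons A x))%N & diff z t (rcons A x)`_l.
  move=> [l lA D]; exists l; last by rewrite nth_old.
  by rewrite size_rcons ltnS ltnW.
move=> j k jA kA; move: j jA k kA.
apply: rcons_ind => [|j jA]; apply: rcons_ind => [|k kA].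
- by [].
- rewrite nth_last nth_old // => vx e ne; apply/ok/dx => //.
  by move=> e'; apply: ne.
- rewrite nth_last nth_old // => vj e ne.
  have vx : visible x by have [m mr lm] := vj; exists m; rewrite -?e.
  by have [l lA D] := dx vx j jA e ne; apply: ok; exists l => //; exact: diff_sym.
- by rewrite !nth_old // => vj e ne; apply/ok/clA.
Qed.

(** [step A x A' w]: [A'] is a closed extension of [A] containing [x], and the
    word [w] describes it up to isomorphism over [A]. In the last case [x] is
    placed relative to the nearest element of [A] in its level, after their
    first difference [i] has been adjoined. *)
Inductive step A : M -> seq M -> seq nat -> Prop :=
| step_in x k : (k < size A)%N -> A`_k = x -> step A x A [:: 0; k]
| step_free x c : notin A x -> ~ visible x -> (c <= size A)%N -> cut A x c ->
    step A x (rcons A x) [:: 1; c]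
| step_tree x i A1 w m c k : step A i A1 w -> notin A1 x -> (k < r)%N ->
    lev x = lvl k -> (m < size A1)%N -> lev A1`_m = lvl k ->
    diff x A1`_m i ->
    (forall j, (j < size A1)%N -> lev A1`_j = lvl k ->
      forall i', diff x A1`_j i' -> i' = i \/ rlt i' i) ->
    (c <= size A1)%N -> cut A1 x c ->
    step A x (rcons A1 x) [:: 2, m, c, k & w].

(** * One-point extensions and their words *)

Lemma step_size A x A' w : step A x A' w -> (size A <= size A')%N.
Proof.
by elim=> // {x A' w} [x c|x i A1 w m c k _ IH] *; rewrite size_rcons ltnW // ltnS.
Qed.

Lemma step_nth A x A' w : step A x A' w ->
  forall j, (j < size A)%N -> A'`_j = A`_j.
Proof.
elim=> // {x A' w} [x c|x i A1 w m c k sA1 IH] *; first by rewrite nth_old.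
by rewrite nth_old ?IH //; exact: leq_trans (step_size sA1).
Qed.

Lemma step_mem A x A' w : step A x A' w -> exists2 p, (p < size A')%N & A'`_p = x.
Proof.
case=> {x A' w} [x k|x c|x i A1 w m c k] *; first by exists k.
  by exists (size A); rewrite ?size_rcons // nth_last.
by exists (size A1); rewrite ?size_rcons // nth_last.
Qed.

Lemma step_lev A x A' w : step A x A' w ->
  forall j, (size A <= j < size A')%N -> lev A'`_j = lev x \/ lev_lt (lev A'`_j) (lev x).
Proof.
elim=> {x A' w} [x k _ _ j|x c _ _ _ _ j|x i A1 w m c k _ IH nx kr lx mA1 lm [_ ix _] _ _ _ j].
- by lia.
- rewrite size_rcons => jA; have -> : j = size A by lia.
  by rewrite nth_last; left.
- rewrite size_rcons => jA.
  have [->|jA1] := eqVneq j (size A1); first by rewrite nth_last; left.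
  have jA1' : (j < size A1)%N by lia.
  rewrite nth_old //; right; have [|->//|ji] := IH j; first by lia.
  exact: lev_lt_trans ji ix.
Qed.

Lemma step_closed A x A' w : closed A -> step A x A' w -> closed A'.
Proof.
move=> clA; elim=> // {x A' w} [x c nx vx _ _|]; first exact: closed_rcons.
move=> x i A1 w m c k sA1 clA1 nx kr lx mA1 lm xm near _ _.
have [p pA1 pi] := step_mem sA1.
apply: closed_rcons => // vx j jA1 lj ne.
have lmj : lev A1`_m = lev A1`_j by rewrite lj lm lx.
have [e|ne'] := pselect (A1`_m = A1`_j); first by exists p; rewrite -?e ?pi.
have [|l lA1 D] := clA1 m j mA1 jA1 _ lmj ne'; first by exists k.
have nearj := near j jA1 (etrans lj lx).
have [il|li|il] := totM A1`_l i.
(* If the [m]-th and [j]-th points also split at [i], then [x] leaves the [j]-th point above [i],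
   against the choice of [m]. *)
- have [|||i' D'] := @diff_ex _ _ x A1`_j; first by move=> e; apply: ne.
  + by [].
  + by rewrite lx; exact: lvl_some.
  rewrite il in D; have ii' := diff_trans_eq xm D D'.
  have [e|i'i] := nearj _ D'; first by case: (@irrM i); rewrite -{2}e.
  by case: (@irrM i); exact: trM ii' i'i.
- by exists l => //; exact: diff_trans_gt xm D li.
- by exists p; rewrite ?pi //; exact: diff_trans_lt xm D il.
Qed.

(** All choices of a step are recorded in [w] as indices, and [diff_nearest] expresses the relations
    of the new point through old ones. *)
Lemma step_iso A B x y A' B' w : closed A -> iso A B ->
    step A x A' w -> step B y B' w ->
  iso A' B' /\ exists p, [/\ (p < size A')%N, A'`_p = x & B'`_p = y].
Proof.
move=> clA AB sA; have clB := iso_closed AB clA; have [sz lt st df] := AB.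
elim: sA y B' => {x A' w} [x k kA kx|x c nx vx _ cx|
  x i A1 w m c k sA1 IH nx kr lx mA1 lm xm near _ cx] y B' sB.
- by inversion sB; subst; split=> //; exists k.
- inversion sB as [|? ? ny vy _ cy|]; subst.
  split; last first.
    by exists (size A); rewrite size_rcons nth_last; split=> //; rewrite sz nth_last.
  apply: iso_rcons AB nx ny cx cy _ _ => // k kr.
  by split=> lk; [case: vx|case: vy]; exists k.
- inversion sB as [| |? i' B1 ? ? ? ? sB1 ny _ ly mB1 lm' ym near' _ cy]; subst.
  have [AB1 [p [pA1 pi pi']]] := IH _ _ sB1.
  have [sz1 lt1 st1 df1] := AB1.
  split; last first.
    by exists (size A1); rewrite size_rcons nth_last; split=> //; rewrite sz1 nth_last.
  have clA1 := step_closed clA sA1.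
  have vm : visible A1`_m by exists k.
  apply: (@iso_rcons A1 B1 x y c) => //.
    move=> k' kr'; split=> [lx'|ly'].
      by rewrite ly; rewrite -lx' lx.
    by rewrite lx; rewrite -ly' ly.
  move=> _ j l jA1 lA1.
  have [lj|nlj] := pselect (lev A1`_j = lvl k); last first.
    split=> -[e _ _]; case: nlj; first by rewrite -e.
    by apply/st1 => //; rewrite -e.
  have ljB : lev B1`_j = lvl k by apply/st1.
  have BA1 := iso_sym AB1.
  rewrite (diff_nearest _ xm (near j jA1 lj)) ?lj ?lx //.
  rewrite (diff_nearest _ ym (near' j _ ljB)) ?ljB ?ly -?sz1 //.
  have eqi u v : (u < size A1)%N -> (v < size A1)%N -> A1`_u = A1`_v <-> B1`_u = B1`_v.
    by move=> uA vA; split=> [/(iso_eq AB1 uA vA)//|]; apply: (iso_eq BA1); rewrite -sz1.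
  have clB1 := iso_closed AB1 clA1.
  have vmB : visible B1`_m by exists k.
  (* Closure turns the quantifier over [M] in [diff_nearest] into one over indices, which the
     isomorphism preserves. *)
  have split_ex C (clC : closed C) (vC : visible C`_m) i0 q :
      (m < size C)%N -> (j < size C)%N ->
      (exists2 c0, diff C`_m C`_j c0 & rlt c0 i0 /\ q = c0 \/ rlt i0 c0 /\ q = i0) <->
      (exists2 c0, (c0 < size C)%N & diff C`_m C`_j C`_c0 /\
         (rlt C`_c0 i0 /\ q = C`_c0 \/ rlt i0 C`_c0 /\ q = i0)).
    move=> mC jC; split=> [[c0 D h]|[c0 cC [D h]]]; last by exists C`_c0.
    have [lmj _ _] := D.
    have [|c1 c1C D1] := clC m j mC jC vC lmj.
      by move=> e; move: D; rewrite e => /diff_irr.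
    by exists c1 => //; rewrite -(diff_uniq D D1).
  rewrite !split_ex -?sz1 // -pi -pi'.
  split=> -[[e1 e2]|[c0 c0A [D h]]].
  + by left; split; apply/eqi.
  + right; exists c0 => //; split; first exact/df1.
    by case: h => -[h1 h2]; [left|right]; split; by [apply/lt1|apply/eqi].
  + by left; split; apply/eqi.
  + right; exists c0 => //; split; first exact/df1.
    by case: h => -[h1 h2]; [left|right]; split; by [apply/lt1|apply/eqi].
Qed.

(** * Extending a partial isomorphism *)

Lemma gap (a : option W) (Q : M -> Prop) (B : seq M) (U : nat -> Prop) :
    (forall u v, ltO u v -> (forall x, u = Some x -> lev x = a) ->
      (forall x, v = Some x -> lev x = a) ->
      exists y, [/\ lev y = a, ltO u (Some y), ltO (Some y) v & Q y]) ->
    (forall j k, (j < size B)%N -> (k < size B)%N -> U j -> ~ U k -> rlt B`_j B`_k) ->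
    (forall j, (j < size B)%N -> lev_lt (lev B`_j) a -> U j) ->
    (forall j, (j < size B)%N -> lev_lt a (lev B`_j) -> ~ U j) ->
  exists y, [/\ lev y = a, Q y, forall j, (j < size B)%N -> U j -> rlt B`_j y
             & forall j, (j < size B)%N -> ~ U j -> rlt y B`_j].
Proof.
move=> dense Ulin Ulow Uhigh.
pose lo j := lev B`_j = a /\ U j; pose hi j := lev B`_j = a /\ ~ U j.
(* Levels are convex, so only the points of [B] in level [a] constrain [y]; [u] and [v] are the
   nearest of these on either side of the cut. *)
have [u [ua uP u_hi]] : exists u : option M, [/\ forall x, u = Some x -> lev x = a,
    forall j y, (j < size B)%N -> lo j -> ltO u (Some y) -> rlt B`_j y &
    forall x k, (k < size B)%N -> hi k -> u = Some x -> rlt x B`_k].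
  have [none|[u [uB [la Uu] umax]]] := finite_max (size B) (nth x0 B) lo linM.
    by exists None; split=> // j y jB lj; case: (none j).
  exists (Some B`_u); split.
  - by move=> x [<-].
  - by move=> j y jB lj uy; have [->//|ju] := umax j jB lj; exact: trM ju uy.
  - by move=> x k kB [_ Uk] [<-]; exact: Ulin.
have [v [va vP uv]] : exists v : option M, [/\ forall x, v = Some x -> lev x = a,
    forall j y, (j < size B)%N -> hi j -> ltO (Some y) v -> rlt y B`_j & ltO u v].
  have [none|[v [vB [la Uv] vmin]]] := finite_min (size B) (nth x0 B) hi linM.
    exists None; split=> //; last by case: (u).
    by move=> j y jB lj; case: (none j).
  exists (Some B`_v); split.
  - by move=> x [<-].
  - by move=> j y jB lj yv; have [->//|vj] := vmin j jB lj; exact: trM yv vj.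
  - case: (u) u_hi => // x u_hi; exact: (u_hi x v).
have [y [ya uy yv Qy]] := dense u v uv ua va; exists y; split=> // j jB Uj.
- have [lj|lj|lj] := lev_lt_total (lev B`_j) a.
  + exact: uP.
  + by apply: lev_lt_rlt; rewrite ya.
  + by case: (Uhigh j).
- have [lj|lj|lj] := lev_lt_total (lev B`_j) a.
  + exact: vP.
  + by case: Uj; exact: Ulow.
  + by apply: lev_lt_rlt; rewrite ya.
Qed.

Lemma not_rlt A x j : notin A x -> (j < size A)%N -> ~ rlt A`_j x -> rlt x A`_j.
Proof. by move=> nx jA; have [/nx|//|//] := totM A`_j x => /(_ jA). Qed.

Lemma between_notin B y (U : nat -> Prop) :
    (forall j, (j < size B)%N -> U j -> rlt B`_j y) ->
    (forall j, (j < size B)%N -> ~ U j -> rlt y B`_j) -> notin B y.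
Proof.
move=> lo hi j jB e; have [Uj|Uj] := pselect (U j).
  by have := lo j jB Uj; rewrite e => /irrM.
by have := hi j jB Uj; rewrite e => /irrM.
Qed.

(** If a neighbour of the cut in [B] lies in an invisible level, a point of that level fills the
    cut. Otherwise the neighbours lie in visible levels, which the isomorphism respects; the level
    of [x] is strictly on the right side of each of them, so [x] itself fills the cut. *)
Lemma free_forth A B x c : iso A B -> notin A x -> ~ visible x -> cut A x c ->
  exists y, [/\ ~ visible y,
    forall j, (j < size A)%N -> rlt A`_j x -> rlt B`_j y &
    forall j, (j < size A)%N -> ~ rlt A`_j x -> rlt y B`_j].
Proof.
move=> AB nx vx cx; have [sz lt st df] := AB.
pose good y := [/\ ~ visible y,
    forall j, (j < size A)%N -> rlt A`_j x -> rlt B`_j y &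
    forall j, (j < size A)%N -> ~ rlt A`_j x -> rlt y B`_j].
have lev_dense a u v : ltO u v -> (forall x, u = Some x -> lev x = a) ->
    (forall x, v = Some x -> lev x = a) ->
    exists y : M, [/\ lev y = a, ltO u (Some y), ltO (Some y) v & True].
  by move=> uv ua va; have [y [? ? ?]] := tower_dense uv ua va; exists y.
have Ulin j k : (j < size B)%N -> (k < size B)%N -> rlt A`_j x -> ~ rlt A`_k x ->
    rlt B`_j B`_k.
  rewrite -!sz => jA kA jx nkx; apply/lt => //.
  exact: trM jx (not_rlt nx kA nkx).
have place d : (d < size A)%N -> ~ visible B`_d ->
    (forall j, (j < size A)%N -> rlt A`_j A`_d -> rlt A`_j x) ->
    (forall j, (j < size A)%N -> rlt A`_d A`_j -> ~ rlt A`_j x) ->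
    exists y, good y.
  move=> dA vd below above.
  have [| |y [ly _ lo hi]] := gap (lev_dense (lev B`_d)) Ulin.
  - move=> j; rewrite -sz => jA /lev_lt_rlt/lt h; exact: below (h jA dA).
  - move=> j; rewrite -sz => jA /lev_lt_rlt/lt h; exact: above (h dA jA).
  rewrite -sz in lo hi; exists y; split=> // -[k kr lk]; apply: vd; exists k => //.
  by rewrite -ly.
have low : (exists y, good y) \/ forall j, (j < size A)%N -> rlt A`_j x -> rlt B`_j x.
  have [cA|cA] := ltnP c (size A); last first.
    by right=> j jA /(cx j jA)[]; rewrite ltnNge cA.
  have cx' : rlt A`_c x by apply/cx => //; split=> //; left.
  have [vc|nvc] := pselect (visible B`_c); last first.
    left; apply: (place c cA nvc) => j jA jc; first exact: trM jc cx'.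
    move=> /(cx j jA)[_ [e|h]]; first by move: jc; rewrite e => /irrM.
    by case: (@irrM A`_c); exact: trM jc h.
  right=> j jA /(cx j jA)[_ jc].
  have xc : rlt B`_c x.
    have [k kr lk] := vc; have lkA : lev A`_c = lvl k by apply/st.
    apply: lev_lt_rlt; rewrite lk -lkA; have [e|//] := rlt_lev cx'.
    by case: vx; exists k; rewrite // -e.
  case: jc => [e|jc]; first by rewrite (iso_eq AB jA cA e).
  by apply: trM xc; apply/lt.
have high : (exists y, good y) \/ forall j, (j < size A)%N -> ~ rlt A`_j x -> rlt x B`_j.
  have [none|[v [vA vx' vmin]]] :=
    finite_min (size A) (nth x0 A) (fun j => ~ rlt A`_j x) linM; first by right=> j /none.
  have [vv|nvv] := pselect (visible B`_v); last first.
    left; apply: (place v vA nvv) => j jA jv; last first.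
      by move=> jx; apply: vx'; exact: trM jv jx.
    apply: contrapT => jx; have [e|vj] := vmin j jA jx.
      by move: jv; rewrite e => /irrM.
    by case: (@irrM A`_v); exact: trM vj jv.
  right=> j jA jx; have xv : rlt x B`_v.
    have [k kr lk] := vv; have lkA : lev A`_v = lvl k by apply/st.
    apply: lev_lt_rlt; rewrite lk -lkA; have [e|//] := rlt_lev (not_rlt nx vA vx').
    by case: vx; exists k; rewrite // e.
  have [e|vj] := vmin j jA jx; first by rewrite (iso_eq AB jA vA e).
  by apply: trM xv _; apply/lt.
by case: low => [//|low]; case: high => [//|high]; exists x.
Qed.

Lemma step_forth A B x A' w : closed A -> iso A B -> step A x A' w ->
  exists y B', step B y B' w.
Proof.
move=> clA AB sA; have [sz lt st df] := AB.
elim: sA => {x A' w} [x k kA kx|x c nx vx cA cx|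
  x i A1 w m c k sA1 IH nx kr lx mA1 lm xm near cA1 cx].
- by exists B`_k, B; apply: step_in; rewrite -?sz.
- have [y [vy lo hi]] := free_forth AB nx vx cx.
  have ny : notin B y by apply: (@between_notin _ _ (fun j => rlt A`_j x)); rewrite -sz.
  exists y, (rcons B y); apply: step_free => //; first by rewrite -sz.
  apply: (cut_transfer AB cx) => j jA; split; first exact: lo.
  move=> jy; apply: contrapT => /(hi j jA) yj.
  by case: (@irrM y); exact: trM yj jy.
- have [i' [B1 sB1]] := IH.
  have [AB1 [p [pA1 pi pi']]] := step_iso clA AB sA1 sB1.
  have [sz1 lt1 st1 df1] := AB1; have clA1 := step_closed clA sA1.
  have lmB : lev B1`_m = lvl k by apply/st1.
  have lik : lev_lt (lev i) (lvl k) by rewrite -lx; case: xm.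
  have li' : lev_lt (lev i') (lev B1`_m).
    have : rlt B1`_p B1`_m.
      by apply/lt1 => //; apply: lev_lt_rlt; rewrite pi lm.
    rewrite pi' => /rlt_lev[e|//]; rewrite lmB in e.
    have : lev A1`_p = lvl k by apply/st1; rewrite ?pi'.
    by rewrite pi => e'; move: lik; rewrite e' => /lev_lt_irr.
  (* The tree condition on [y] is membership in a ball; balls are dense in their level by
     [tower_split_dense], so it can be met inside the prescribed cut. *)
  pose Q y := diff B1`_m y i'.
  have dense u v : ltO u v -> (forall x, u = Some x -> lev x = lvl k) ->
      (forall x, v = Some x -> lev x = lvl k) ->
      exists y, [/\ lev y = lvl k, ltO u (Some y), ltO (Some y) v & Q y].
    rewrite -lmB => uv ua va.
    have [y [ly ? ? sp]] := tower_split_dense uv li' ua va.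
    by exists y; split=> //; split=> //; rewrite ly.
  have [|||y [ly my lo hi]] := @gap _ Q B1 (fun j => rlt A1`_j x) dense.
  + move=> j l; rewrite -!sz1 => jA lA jx nlx; apply/lt1 => //.
    exact: trM jx (not_rlt nx lA nlx).
  + move=> j; rewrite -sz1 => jA lj; apply: lev_lt_rlt; rewrite lx.
    have /lt1 : rlt B1`_j B1`_m by apply: lev_lt_rlt; rewrite lmB.
    move=> /(_ jA mA1)/rlt_lev; rewrite lm => -[/(st1 _ _ jA kr) e|//].
    by move: lj; rewrite e => /lev_lt_irr.
  + move=> j; rewrite -sz1 => jA lj jx.
    have /lt1 : rlt B1`_m B1`_j by apply: lev_lt_rlt; rewrite lmB.
    move=> /(_ mA1 jA)/rlt_lev; rewrite lm => -[/esym/(st1 _ _ jA kr) e|].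
      by move: lj; rewrite e => /lev_lt_irr.
    by rewrite -lx => /lev_lt_rlt xj; case: (@irrM x); exact: trM xj jx.
  have ny : notin B1 y by exact: between_notin lo hi.
  have ym : diff y B1`_m i' by exact: diff_sym.
  exists y, (rcons B1 y); apply: (step_tree sB1 ny kr ly _ lmB ym);
    rewrite -?sz1 //; last first.
    apply: (cut_transfer AB1 cx) => j jA; split; first by apply: lo; rewrite -sz1.
    move=> jy; apply: contrapT => njx; have := hi j; rewrite -sz1 => /(_ jA njx) yj.
    by case: (@irrM y); exact: trM yj jy.
  move=> j jA ljB i1 D1.
  have lj : lev A1`_j = lvl k by apply/st1.
  have [e|ne] := pselect (B1`_j = B1`_m).
    by left; move: D1; rewrite e => D1; exact: diff_uniq D1 ym.
  have BA1 := iso_sym AB1.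
  have [|l lA D] := clA1 m j mA1 jA (ex_intro2 _ _ k kr lm) (etrans lm (esym lj)).
    by move=> /(iso_eq AB1 mA1 jA)/esym.
  have DB : diff B1`_m B1`_j B1`_l by apply/df1 => //; exists k.
  have [il|il|li] := totM i A1`_l.
  + have [|||i2 D2] := @diff_ex _ _ x A1`_j; first exact/nesym/nx.
    * by rewrite lx lj.
    * by rewrite lx; exact: lvl_some.
    rewrite -il in D; have ii2 := diff_trans_eq xm D D2.
    have [e|i2i] := near j jA lj _ D2; first by case: (@irrM i); rewrite -{2}e.
    by case: (@irrM i); exact: trM ii2 i2i.
  + have il' : rlt i' B1`_l by rewrite -pi'; apply/lt1 => //; rewrite pi.
    by left; exact: diff_uniq D1 (diff_trans_lt ym DB il').
  + have li'' : rlt B1`_l i' by rewrite -pi'; apply/lt1 => //; rewrite pi.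
    by right; rewrite (diff_uniq D1 (diff_trans_gt ym DB li'')).
Qed.

(** * Existence and length of the words *)

Definition below_count x : nat :=
  count (fun k => `[< lvl k = lev x \/ lev_lt (lvl k) (lev x) >]) (iota 0 r).

(** A first difference lies in a strictly lower level, so at least the entry [k] drops out of the
    count. The nesting of [step] is therefore bounded by [r], independently of [A]. *)
Lemma below_count_lt x i k : (k < r)%N -> lev x = lvl k ->
  lev_lt (lev i) (lev x) -> (below_count i < below_count x)%N.
Proof.
move=> kr lx ix; rewrite /below_count.
set p := fun k => _; set q := fun k => `[< _ \/ lev_lt _ (lev x) >].
have sub : subpred p q.
  move=> l /asboolP h; apply/asboolP; right.
  by case: h => [->//|h]; exact: lev_lt_trans ix.
have qk : q k by apply/asboolP; left.
have npk : ~~ p k.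
  apply/negP => /asboolP; rewrite -lx => -[e|h].
    by move: ix; rewrite e => /lev_lt_irr.
  by apply: (@lev_lt_irr W (lev x)); exact: lev_lt_trans h ix.
have kin : k \in iota 0 r by rewrite mem_iota.
have := count_predUI p (pred1 k) (iota 0 r).
rewrite [count (predI _ _) _](_ : _ = 0) ?addn0; last first.
  apply/eqP; rewrite -leqn0 leqNgt -has_count; apply/hasPn => l _ /=.
  by have [->|_] := eqVneq l k; rewrite ?andbF // andbT.
rewrite count_uniq_mem ?iota_uniq // kin addn1 => <-.
by apply: sub_count => l /= /orP[/sub//|/eqP ->].
Qed.

Lemma below_count_le x : (below_count x <= r)%N.
Proof. by rewrite -[leqRHS](size_iota 0) count_size. Qed.

Definition has_levels A := forall k, (k < r)%N ->
  exists2 j, (j < size A)%N & lev A`_j = lvl k.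

(** The word takes four entries for each nested difference and two for the innermost case. The tags
    are below 3, the level index is below [r], and all other entries are at most [size A']. *)
Lemma step_ex A x : closed A -> has_levels A -> exists A' w,
  [/\ step A x A' w, (size A' <= size A + (below_count x).+1)%N,
      (size w <= 2 + 4 * below_count x)%N
    & all (fun e => e < size A' + r + 3)%N w].
Proof.
move=> clA lvA; move: {2}(below_count x).+1 (ltnSn (below_count x)) => n.
elim: n x => [//|n IH] x xn.
have [[k kA kx]|nx] := pselect (exists2 k, (k < size A)%N & A`_k = x).
  by exists A, [:: 0; k]; split; [exact: step_in|lia|rewrite /=; lia|rewrite /=; lia].
have nxA : notin A x by move=> j jA jx; apply: nx; exists j.
have [vx|nvx] := pselect (visible x); last first.
  have [c cA cx] := cut_ex A x; exists (rcons A x), [:: 1; c].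
  by split; [exact: step_free|rewrite size_rcons; lia|rewrite /=; lia|
             rewrite /= size_rcons; lia].
have [k kr lx] := vx; have [j0 j0A lj0] := lvA k kr.
have xne j : (j < size A)%N -> lev A`_j = lvl k -> exists i, diff x A`_j i.
  move=> jA lj; apply: diff_ex; [exact/nesym/nxA|by rewrite lx lj|by rewrite lx; exact: lvl_some].
have /choice[f fP] j : exists i, (j < size A)%N -> lev A`_j = lvl k ->
    diff x A`_j i.
  have [[jA lj]|h] := pselect ((j < size A)%N /\ lev A`_j = lvl k).
    by have [i D] := xne j jA lj; exists i.
  by exists x0 => jA lj; case: h.
have [none|[m [mA lm mmax]]] := finite_max (size A) f
    (fun j => lev A`_j = lvl k) linM; first by case: (none j0).
have xm := fP m mA lm; set i := f m in xm.
have ix : lev_lt (lev i) (lev x) by case: xm.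
have lt := below_count_lt kr lx ix.
have [|A1 [w [sA1 szA1 szw allw]]] := IH i; first by lia.
have [c cA1 cx] := cut_ex A1 x.
have AA1 := step_size sA1; have A1E := step_nth sA1.
(* The points adjoined for [i] lie in lower levels than [x], so the nearest point found in [A] is
   still nearest in [A1]. *)
have new j : (size A <= j < size A1)%N -> lev A1`_j <> lev x.
  move=> /(step_lev sA1) [->|h] e; first by move: ix; rewrite e => /lev_lt_irr.
  by move: (lev_lt_trans h ix); rewrite e => /lev_lt_irr.
exists (rcons A1 x), [:: 2, m, c, k & w]; split.
- apply: (step_tree sA1 _ kr lx _ _ _ _ cA1 cx).
  + move=> j jA1 e; have [jA|jA] := ltnP j (size A).
      by apply: (nxA j jA); rewrite -A1E.
    by apply: (new j); rewrite ?jA ?jA1 // e.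
  + exact: leq_trans mA AA1.
  + by rewrite A1E.
  + by rewrite A1E.
  + move=> j jA1 lj i' D'; have [jA|jA] := ltnP j (size A); last first.
      by case: (new j); rewrite ?jA ?jA1 // lj lx.
    rewrite A1E // in lj D'.
    by rewrite (diff_uniq D' (fP j jA lj)); exact: mmax.
- by rewrite size_rcons; lia.
- by rewrite /=; lia.
- rewrite /= size_rcons; apply/and4P; split; try lia.
  by apply/andP; split; [lia|apply: sub_all allw => e; lia].
Qed.

Fixpoint steps A (xs : seq M) A' (ws : seq (seq nat)) : Prop :=
  match xs, ws with
  | [::], [::] => A = A'
  | x :: xs, w :: ws => exists2 A1, step A x A1 w & steps A1 xs A' ws
  | _, _ => False
  end.

Lemma steps_size A xs A' ws : steps A xs A' ws ->
  (size A <= size A')%N /\ size xs = size ws.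
Proof.
elim: xs A ws => [|x xs IH] A [|w ws] //=; first by move=> ->.
by move=> [A1 /step_size AA1 /IH[A1A' ->]]; split=> //; exact: leq_trans A1A'.
Qed.

Lemma steps_nth A xs A' ws : steps A xs A' ws ->
  forall j, (j < size A)%N -> A'`_j = A`_j.
Proof.
elim: xs A ws => [|x xs IH] A [|w ws] //=; first by move=> ->.
move=> [A1 sA1 /IH h] j jA; rewrite h ?(step_nth sA1) //.
exact: leq_trans jA (step_size sA1).
Qed.

Lemma steps_closed A xs A' ws : closed A -> steps A xs A' ws -> closed A'.
Proof.
elim: xs A ws => [|x xs IH] A [|w ws] //=; first by move=> ? <-.
by move=> clA [A1 /(step_closed clA)/IH h /h].
Qed.

Lemma steps_mem A xs A' ws : steps A xs A' ws -> forall k, (k < size xs)%N ->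
  exists2 p, (p < size A')%N & A'`_p = xs`_k.
Proof.
elim: xs A ws => [|x xs IH] A [|w ws] //= [A1 sA1 sA'] [_|k kxs].
  have [p pA1 pE] := step_mem sA1; have [h _] := steps_size sA'.
  by exists p; [exact: leq_trans h|rewrite (steps_nth sA')].
by have [p pA' pE] := IH _ _ sA' k kxs; exists p.
Qed.

Lemma has_levelsW A A' : (size A <= size A')%N ->
  (forall j, (j < size A)%N -> A'`_j = A`_j) -> has_levels A -> has_levels A'.
Proof.
move=> AA' h lvA k /lvA[j jA lj]; exists j; first exact: leq_trans AA'.
by rewrite h.
Qed.

Lemma steps_ex A xs : closed A -> has_levels A -> exists A' ws,
  [/\ steps A xs A' ws, (size A' <= size A + size xs * r.+1)%N,
      all (fun w => size w <= 2 + 4 * r)%N ws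
    & all (all (fun e => e < size A' + r + 3)%N) ws].
Proof.
elim: xs A => [|x xs IH] A clA lvA; first by exists A, [::]; split=> //=; lia.
have [A1 [w [sA1 szA1 szw allw]]] := step_ex x clA lvA.
have [||A' [ws [sA' szA' szws allws]]] := IH A1.
- exact: step_closed sA1.
- exact: has_levelsW (step_size sA1) (step_nth sA1) lvA.
have bx := below_count_le x; have [A1A' _] := steps_size sA'.
exists A', (w :: ws); split=> /=.
- by exists A1.
- by rewrite mulSn; lia.
- by rewrite szws andbT; lia.
- by rewrite allws andbT; apply: sub_all allw => e; lia.
Qed.

Lemma steps_iso A B xs ys A' B' ws : closed A -> iso A B ->
    steps A xs A' ws -> steps B ys B' ws ->
  iso A' B' /\ forall k, (k < size xs)%N ->
    exists p, [/\ (p < size A')%N, A'`_p = xs`_k & B'`_p = ys`_k].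
Proof.
elim: xs ys A B ws => [|x xs IH] [|y ys] A B [|w ws] //= clA AB; first by move=> <- <-.
move=> [A1 sA1 sA'] [B1 sB1 sB'].
have [AB1 [p [pA1 px py]]] := step_iso clA AB sA1 sB1.
have [AB' h] := IH _ _ _ _ (step_closed clA sA1) AB1 sA' sB'.
split=> // -[_|k /h//]; have [A1A' _] := steps_size sA'; have [B1B' _] := steps_size sB'.
have [sz1 _ _ _] := AB1; exists p; rewrite (steps_nth sA') // (steps_nth sB') -?sz1 //.
by split=> //; exact: leq_trans A1A'.
Qed.

(** * Counting words against subsets *)

Lemma poly_lt_exp2 a b e : exists n, ((a + b * n) ^ e < 2 ^ n)%N.
Proof.
(* For this [n] the left side is at most 2 to the power [(c + 3 * u) * e]; this exponent is at most
   [4 * u ^ 2], which is below [u.+1 ^ 3] and hence below [(2 ^ u) ^ 3], that is, [n]. *)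
pose c := a + b; pose u := c + e + 3; exists (2 ^ (3 * u)).
have cu : (c <= u)%N by rewrite /u; lia.
have eu : (e <= u)%N by rewrite /u; lia.
have u3 : (3 <= u)%N by rewrite /u; lia.
have base_le : (a + b * 2 ^ (3 * u) <= 2 ^ (c + 3 * u))%N.
  rewrite expnD; have : (c <= 2 ^ c)%N by exact: ltnW (ltn_expl c (isT : 1 < 2)).
  have := expn_gt0 2 (3 * u); rewrite /c /=; nia.
apply: leq_ltn_trans (_ : (2 ^ ((c + 3 * u) * e) < _)%N).
  by rewrite (expnM 2 (c + 3 * u) e); case: (e) => [|d]; rewrite ?expn0 // leq_exp2r.
rewrite ltn_exp2l //; have : (u < 2 ^ u)%N by exact: ltn_expl.
rewrite [(3 * u)%N]mulnC expnM; move: (2 ^ u) => t ut.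
have : (u.+1 ^ 3 <= t ^ 3)%N by rewrite leq_exp2r.
rewrite !expnS expn0 !muln1; nia.
Qed.

(** The default [B] lies outside the alphabet, so the padding also records the length. *)
Lemma seq_eq_padded (B d : nat) (w w' : seq nat) :
    all (fun e => e < B)%N w -> all (fun e => e < B)%N w' ->
    (size w <= d)%N -> (size w' <= d)%N ->
    (forall k, (k < d)%N -> nth B w k = nth B w' k) -> w = w'.
Proof.
move=> allw allw' wd w'd e.
have le u u' : all (fun e => e < B)%N u' -> (size u' <= d)%N ->
    (forall k, (k < d)%N -> nth B u k = nth B u' k) -> (size u' <= size u)%N.
  move=> /(all_nthP B) allu' u'd e'; rewrite leqNgt; apply/negP => lt.
  have := allu' _ lt; rewrite -e' ?nth_default ?ltnn //; exact: leq_trans lt u'd.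
have sz : size w = size w'.
  apply/eqP; rewrite eqn_leq (le w' w) //= ?(le w w') // => k kd; exact/esym/e.
by apply: (@eq_from_nth _ B) => // k kw; apply: e; exact: leq_trans wd.
Qed.

Section Shatter.
Variable A0 : seq M.

Definition extends A := (size A0 <= size A)%N /\
  forall j, (j < size A0)%N -> A`_j = A0`_j.

Lemma steps_extends A xs A' ws : extends A -> steps A xs A' ws -> extends A'.
Proof.
move=> [sz h] sA; have [AA' _] := steps_size sA.
split=> [|j jA0]; first exact: leq_trans AA'.
by rewrite (steps_nth sA) ?h //; exact: leq_trans sz.
Qed.

(** Over a closed set [A] containing all [a i], of size linear in [N], the words describing [b s]
    determine [s]. They have bounded length over an alphabet linear in [N], so there are only
    polynomially many of them for [2 ^ N] subsets. *)
Lemma no_shattering (n m : nat) (R : ('I_n -> M) -> ('I_m -> M) -> Prop) :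
    closed A0 -> has_levels A0 ->
    (forall A B (s : 'I_n -> nat) (t : 'I_m -> nat),
      closed A -> iso A B -> extends A -> extends B ->
      (forall i, (s i < size A)%N) -> (forall i, (t i < size A)%N) ->
      R (fun i => A`_(s i)) (fun i => A`_(t i)) ->
      R (fun i => B`_(s i)) (fun i => B`_(t i))) ->
  exists N, forall (a : 'I_N -> 'I_n -> M) (b : {set 'I_N} -> 'I_m -> M),
    ~ forall i s, R (a i) (b s) <-> i \in s.
Proof.
move=> clA0 lvA0 inv.
have [N ltN] := poly_lt_exp2 (size A0 + m * r.+1 + r + 4) (n * r.+1) (m * (2 + 4 * r)).
exists N => a b ab.
have [A [ws0 [sA szA _ _]]] := steps_ex (codom (fun p : 'I_N * 'I_n => a p.1 p.2)) clA0 lvA0.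
have clA := steps_closed clA0 sA.
have [A0A _] := steps_size sA.
have lvA : has_levels A by exact: has_levelsW A0A (steps_nth sA) lvA0.
have extA : extends A by apply: steps_extends sA; split.
rewrite size_codom card_prod !card_ord in szA.
have posA i k : exists2 p, (p < size A)%N & A`_p = a i k.
  have [|p pA pE] := steps_mem sA (k := enum_rank (i, k)).
    by rewrite size_codom.
  by exists p => //; rewrite pE nth_codom enum_rankK.
have /choice[c cP] (s : {set 'I_N}) : exists c : seq M * seq (seq nat),
    [/\ steps A (codom (b s)) c.1 c.2, (size c.1 <= size A + m * r.+1)%N,
        all (fun w => size w <= 2 + 4 * r)%N c.2
      & all (all (fun e => e < size c.1 + r + 3)%N) c.2].
  have [A' [ws [h1 h2 h3 h4]]] := steps_ex (codom (b s)) clA lvA.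
  by exists (A', ws); split=> //; move: h2; rewrite size_codom card_ord.
(* A bound for all entries; [B] itself is the padding value, whence the codomain ['I_B.+1] of
   [code]. *)
pose B := size A0 + m * r.+1 + r + 3 + n * r.+1 * N.
pose code (s : {set 'I_N}) : {ffun 'I_m * 'I_(2 + 4 * r) -> 'I_B.+1} :=
  [ffun p : 'I_m * 'I_(2 + 4 * r) => inord (nth B (nth [::] (c s).2 p.1) p.2)].
have wB s j : (j < m)%N -> all (fun e => e < B)%N (nth [::] (c s).2 j).
  move=> jm; have [sc szc _ alls] := cP s; have [_ sz] := steps_size sc.
  rewrite size_codom card_ord in sz.
  move: alls => /(all_nthP [::])/(_ j); rewrite -sz => /(_ jm).
  by apply: sub_all => e; rewrite /B; lia.
have wd s j : (j < m)%N -> (size (nth [::] (c s).2 j) <= 2 + 4 * r)%N.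
  move=> jm; have [sc _ alls _] := cP s; have [_ sz] := steps_size sc.
  rewrite size_codom card_ord in sz.
  by move: alls => /(all_nthP [::])/(_ j); rewrite -sz => /(_ jm).
have code_inj s s' : code s = code s' -> (c s).2 = (c s').2.
  move=> e; have [sc _ _ _] := cP s; have [sc' _ _ _] := cP s'.
  have [_ sz] := steps_size sc; have [_ sz'] := steps_size sc'.
  rewrite size_codom card_ord in sz; rewrite size_codom card_ord in sz'.
  apply: (@eq_from_nth _ [::]); first by rewrite -sz -sz'.
  rewrite -sz => j jm; apply: (seq_eq_padded (wB s j jm) (wB s' j jm)); try exact: wd.
  move=> k kd; have := congr1 (fun f : {ffun 'I_m * 'I_(2 + 4 * r) -> 'I_B.+1} =>
    nat_of_ord (f (Ordinal jm, Ordinal kd))) e.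
  have le s1 : (nth B (nth [::] (c s1).2 j) k < B.+1)%N.
    have [k1|k1] := ltnP k (size (nth [::] (c s1).2 j)); last by rewrite nth_default.
    by move: (wB s1 j jm) => /(all_nthP B)/(_ k k1)/leqW.
  by rewrite !ffunE /= !inordK.
have sub s s' : (c s).2 = (c s').2 -> s \subset s'.
  move=> e; apply/fintype.subsetP => i /ab Ri; apply/ab.
  have [sc _ _ _] := cP s; have [sc' _ _ _] := cP s'; rewrite -e in sc'.
  have [ABs h] := steps_iso clA (iso_refl A) sc sc'.
  have /choice[t tP] (k : 'I_m) : exists p,
      [/\ (p < size (c s).1)%N, (c s).1`_p = b s k & (c s').1`_p = b s' k].
    have [|p [pA p1 p2]] := h (enum_rank k); first by rewrite size_codom.
    by exists p; split=> //; [rewrite p1|rewrite p2]; rewrite nth_codom enum_rankK.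
  have /choice[u uP] (k : 'I_n) : exists p, (p < size A)%N /\ A`_p = a i k.
    by have [p pA pE] := posA i k; exists p.
  have [AAs _] := steps_size sc; have [AAs' _] := steps_size sc'.
  have -> : a i = fun k => (c s').1`_(u k).
    by apply/funext => k; have [uA <-] := uP k; rewrite (steps_nth sc').
  have -> : b s' = fun k => (c s').1`_(t k) by apply/funext => k; have [] := tP k.
  apply: (inv (c s).1) => //.
  - exact: steps_closed sc.
  - exact: steps_extends sc.
  - exact: steps_extends sc'.
  - by move=> k; have [uA _] := uP k; exact: leq_trans AAs.
  - by move=> k; have [] := tP k.
  have <- : a i = fun k => (c s).1`_(u k).
    by apply/funext => k; have [uA <-] := uP k; rewrite (steps_nth sc).
  by have <- : b s = fun k => (c s).1`_(t k) by apply/funext => k; have [] := tP k.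
have inj : injective code.
  move=> s s' /code_inj e; apply/eqP; rewrite finset.eqEsubset.
  by apply/andP; split; apply: sub.
have := leq_card _ inj.
rewrite card_ffun card_prod !card_ord -cardsT -powersetT card_powerset cardsT card_ord.
have -> : B.+1 = size A0 + m * r.+1 + r + 4 + n * r.+1 * N by rewrite /B; lia.
by rewrite leqNgt ltN.
Qed.

End Shatter.

End BackAndForth.

(** * The theory of the tower is dependent *)

Section Logic.
Variable L : language.

Lemma vconsE (D : Type) n (v : 'I_n.+1 -> D) :
  vcons (v ord0) (fun j => v (lift ord0 j)) = v.
Proof.
by apply/funext => i; rewrite /vcons; case: unliftP => [j|] ->.
Qed.

Lemma vcons0 (D : Type) n (x : D) (v : 'I_n -> D) : vcons x v ord0 = x.
Proof. by rewrite /vcons unlift_none. Qed.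

Lemma vconsS (D : Type) n (x : D) (v : 'I_n -> D) j : vcons x v (lift ord0 j) = v j.
Proof. by rewrite /vcons liftK. Qed.

Fixpoint all_close n : formula L n -> sentence L :=
  if n is n'.+1 then fun phi => all_close (All phi) else id.

Lemma holds_all_close (M : structure L) n (phi : formula L n) :
  holds M (all_close phi) <-> forall v, sat (M := M) phi v.
Proof.
elim: n phi => [|n IH] phi.
  split=> [h v|h]; last exact: h.
  by suff -> : v = @vnil M; [|apply/funext => -[]].
rewrite [all_close _]/= IH; split=> h v; last by move=> x; exact: h.
by rewrite -(vconsE v); exact: h.
Qed.

Fixpoint ren_term n k (f : 'I_n -> 'I_k) (t : term L n) : term L k :=
  match t with
  | Var i => Var L (f i)
  | App g ts => App (fun i => ren_term f (ts i))
  end.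

Definition ren_up n k (f : 'I_n -> 'I_k) : 'I_n.+1 -> 'I_k.+1 :=
  vcons ord0 (fun i => lift ord0 (f i)).

Fixpoint ren n k (f : 'I_n -> 'I_k) (phi : formula L n) {struct phi} : formula L k :=
  match phi with
  | Bot => Bot
  | Eql s t => Eql (ren_term f s) (ren_term f t)
  | Rel r ts => Rel (fun i => ren_term f (ts i))
  | Imp phi psi => Imp (ren f phi) (ren f psi)
  | All phi => All (ren (ren_up f) phi)
  end.

Lemma eval_ren (M : structure L) n k (f : 'I_n -> 'I_k) (v : 'I_k -> M) t :
  eval v (ren_term f t) = eval (v \o f) t.
Proof. by elim: t => //= g ts IH; congr fint; apply/funext => i; exact: IH. Qed.

Lemma sat_ren (M : structure L) n (phi : formula L n) k (f : 'I_n -> 'I_k)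
    (v : 'I_k -> M) : sat (ren f phi) v <-> sat phi (v \o f).
Proof.
elim: phi k f v => {n} [n|n s t|n r ts|n phi IH psi IH'|n phi IH] k f v //=.
- by rewrite !eval_ren.
- by under [in X in X <-> _]eq_fun do rewrite eval_ren.
- by rewrite IH IH'.
- have e x : vcons x v \o ren_up f = vcons x (v \o f).
    by apply/funext => i /=; case: (unliftP ord0 i) => [j|] ->;
      rewrite /ren_up !(vconsS, vcons0).
  by split=> h x; move: (h x); rewrite IH e.
Qed.

Definition Conj n (T : Type) (g : T -> formula L n) : seq T -> formula L n :=
  foldr (fun t psi => Neg (Imp (g t) (Neg psi))) (Neg Bot).

Lemma sat_Conj (M : structure L) n (T : eqType) (g : T -> formula L n) (s : seq T)
    (v : 'I_n -> M) : sat (Conj g s) v <-> forall t, t \in s -> sat (g t) v.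
Proof.
elim: s => [|t s IH] /=; first by split=> // _ [].
split=> [h t'|h].
  rewrite inE => /orP[/eqP ->|t's].
    by apply: contrapT => nt; apply: h.
  by move: t' t's; apply/IH; apply: contrapT => ns; apply: h.
apply; first by apply: h; rewrite mem_head.
by apply/IH => t' t's; apply: h; rewrite inE t's orbT.
Qed.

Definition theory_of (M : structure L) : theory L := holds M.

Lemma theory_of_complete M : complete (theory_of M).
Proof.
split; first by exists M => phi.
move=> phi; have [h|h] := pselect (holds M phi); [left|right] => N; exact.
Qed.

Lemma theory_of_transfer (M N : structure L) n (phi : formula L n) :
    models N (theory_of M) -> (forall v, sat (M := M) phi v) ->
  forall v, sat (M := N) phi v.
Proof.
by move=> NT h; apply/holds_all_close/NT/holds_all_close.
Qed.

(** That [k] points are shattered is expressed by one formula with a variable for each coordinate of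
    each [a i] and [b s]. If it is not satisfiable in [M], its negation passes to every model of the
    theory. *)
Lemma theory_of_dependent (M : structure L) :
    (forall n m (phi : formula L (n + m)), exists N,
      forall (a : 'I_N -> 'I_n -> M) (b : {set 'I_N} -> 'I_m -> M),
        ~ forall i s, sat phi (vcat (a i) (b s)) <-> i \in s) ->
  dependent (theory_of M).
Proof.
move=> fin n m phi [N NT [a [b ab]]]; have [k nk] := fin n m phi.
pose T : finType := ('I_k * 'I_n + {set 'I_k} * 'I_m)%type.
pose f (p : 'I_k * {set 'I_k}) (j : 'I_(n + m)) : 'I_#|T| :=
  enum_rank (match fintype.split j with
             | inl l => inl (p.1, l) | inr l => inr (p.2, l) end : T).
pose g (p : 'I_k * {set 'I_k}) :=
  if p.1 \in p.2 then ren (f p) phi else Neg (ren (f p) phi).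
pose psi := Conj g (enum {: 'I_k * {set 'I_k}}).
have vf (D : Type) (a' : 'I_k -> 'I_n -> D) (b' : {set 'I_k} -> 'I_m -> D) v p :
    (forall i l, v (enum_rank (inl (i, l) : T)) = a' i l) ->
    (forall s l, v (enum_rank (inr (s, l) : T)) = b' s l) ->
    v \o f p = vcat (a' p.1) (b' p.2).
  by move=> va vb; apply/funext => j; rewrite /vcat /f /=; case: fintype.split.
have [v Mv] : exists v, sat (M := M) psi v.
  apply: contrapT => nv.
  have h : forall v, sat (M := M) (Neg psi) v by move=> v Mv; apply: nv; exists v.
  pose bs (s : {set 'I_k}) := b [set x | exists2 i : 'I_k, i \in s & val i = x].
  pose v (i : 'I_#|T|) := match (enum_val i : T) with
    | inl p => a p.1 p.2 | inr p => bs p.1 p.2 end.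
  apply: (theory_of_transfer NT h v); apply/sat_Conj => p _.
  have vE := vf _ (fun i : 'I_k => a i) bs v p.
  have e : sat (ren (f p) phi) v <-> p.1 \in p.2.
    rewrite sat_ren vE.
    - rewrite /bs ab; split=> [[i ip /val_inj <-]//|ip]; by exists p.1.
    - by move=> i l; rewrite /v enum_rankK.
    - by move=> s l; rewrite /v enum_rankK.
  by rewrite /g; case: ifP => [|/negP] ip; [apply/e|move=> /e].
pose a' i l := v (enum_rank (inl (i, l) : T)).
pose b' s l := v (enum_rank (inr (s, l) : T)).
apply: (nk a' b') => i s.
move/sat_Conj: Mv => /(_ (i, s)); rewrite mem_enum => /(_ isT); rewrite /g /=.
have vE := vf _ a' b' v (i, s) (fun _ _ => erefl) (fun _ _ => erefl).
case: ifP => is_s /=; rewrite sat_ren vE //.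
Qed.

End Logic.

(** * The language of a tower and its finite parts *)

Inductive tower_symbol (W : Type) :=
| SLt | SLev of W | SDiff of W | SBase of rat.
Arguments SLt {W}.
Arguments SBase {W}.

Definition tower_arity W (s : tower_symbol W) : nat :=
  match s with SLt => 2 | SLev _ => 1 | SDiff _ => 3 | SBase _ => 1 end.

(** Rationals are named by unary predicates instead of constants, so that every term is a
    variable. *)
Definition tower_language (W : Type) : language :=
  @Language void (fun=> 0) (tower_symbol W) (@tower_arity W).

Definition tower_rint (W : wellOrder) (M : tower W) (s : tower_symbol W) :
    ('I_(tower_arity s) -> M) -> Prop :=
  match s with
  | SLt => fun v => rlt (v (@Ordinal 2 0 isT)) (v (@Ordinal 2 1 isT))
  | SLev a => fun v => lev (v ord0) = Some a
  | SDiff a => fun v => lev (v (@Ordinal 3 0 isT)) = Some a /\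
      diff (v (@Ordinal 3 0 isT)) (v (@Ordinal 3 1 isT)) (v (@Ordinal 3 2 isT))
  | SBase q => fun v => v ord0 = base M q
  end.

Definition tower_structure (W : wellOrder) (M : tower W) : structure (tower_language W) :=
  @Structure (tower_language W) M (inhabits (base M 0%R))
    (fun f => match f with end) (@tower_rint W M).

Section TowerNIP.
Variables (W : wellOrder) (M : tower W).
Local Notation TL := (tower_language W).

Fixpoint symbols_in (G : tower_symbol W -> Prop) n (phi : formula TL n) : Prop :=
  match phi with
  | Rel s _ => G s
  | Imp phi psi => symbols_in G phi /\ symbols_in G psi
  | All phi => symbols_in G phi
  | _ => True
  end.

Lemma symbols_inW (G G' : tower_symbol W -> Prop) n (phi : formula TL n) :
  (forall s, G s -> G' s) -> symbols_in G phi -> symbols_in G' phi.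
Proof.
by move=> GG'; elim: phi => //= {n} [n s _ /GG'//|n phi IH psi IH' [/IH ? /IH']].
Qed.

Definition listed (ls : seq W) (qs : seq rat) (s : tower_symbol W) : Prop :=
  match s with
  | SLt => True
  | SLev a | SDiff a => exists2 k, (k < size ls)%N & nth None (map Some ls) k = Some a
  | SBase q => q \in qs
  end.

Lemma listed_catl ls ls' qs qs' s : listed ls qs s -> listed (ls ++ ls') (qs ++ qs') s.
Proof.
have h a : (exists2 k, (k < size ls)%N & nth None (map Some ls) k = Some a) ->
    exists2 k, (k < size (ls ++ ls'))%N & nth None (map Some (ls ++ ls')) k = Some a.
  move=> [k kls e]; exists k; first by rewrite size_cat ltn_addr.
  by rewrite map_cat nth_cat size_map kls.
by case: s => [|a|a|q] //=; [exact: h|exact: h|rewrite mem_cat => ->].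
Qed.

Lemma listed_catr ls ls' qs qs' s : listed ls' qs' s -> listed (ls ++ ls') (qs ++ qs') s.
Proof.
have h a : (exists2 k, (k < size ls')%N & nth None (map Some ls') k = Some a) ->
    exists2 k, (k < size (ls ++ ls'))%N & nth None (map Some (ls ++ ls')) k = Some a.
  move=> [k kls e]; exists (size ls + k); first by rewrite size_cat ltn_add2l.
  by rewrite map_cat nth_cat size_map ltnNge leq_addr /= addKn.
by case: s => [|a|a|q] //=; [exact: h|exact: h|rewrite mem_cat orbC => ->].
Qed.

Lemma symbols_listed n (phi : formula TL n) :
  exists ls qs, symbols_in (listed ls qs) phi.
Proof.
elim: phi => {n} /= [n|n s t|n [|a|a|q] ts|n phi [ls [qs h]] psi [ls' [qs' h']]|n phi //].
- by exists [::], [::].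
- by exists [::], [::].
- by exists [::], [::].
- by exists [:: a], [::], 0.
- by exists [:: a], [::], 0.
- by exists [::], [:: q]; rewrite /= inE.
- exists (ls ++ ls'), (qs ++ qs').
  by split; [apply: symbols_inW h|apply: symbols_inW h'] => c;
    [exact: listed_catl|exact: listed_catr].
Qed.

(** * Invariance of formulas under partial isomorphisms *)

Section Invariance.
Variables (ls : seq W) (qs : seq rat).

Definition marker (a : W) : M := projT1 (cid (lev_inh M (Some a))).

Lemma lev_marker a : lev (marker a) = Some a.
Proof. by rewrite /marker; case: cid. Qed.

(** Fixing the named elements makes [SBase] invariant; the markers ensure that each listed level has
    a nearest point to start from. As a level gets a single marker, no first difference is needed
    for closure. *)
Definition anchor : seq M := map (base M) qs ++ map marker ls.

Local Notation r := (size ls).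
Local Notation lvl := (nth None (map Some ls)).
Local Notation x0 := (base M 0%R).

Lemma lvl_some k : (k < r)%N -> lvl k <> None.
Proof.
case: ls => // a l kr; rewrite (set_nth_default (Some a)) ?size_map //.
by rewrite (nth_map a).
Qed.

Lemma lev_base_none q : lev (base M q) = None.
Proof. by apply/lev_base; exists q. Qed.

Lemma anchorP j : (j < size anchor)%N -> (exists q, nth x0 anchor j = base M q) \/
  exists a, nth x0 anchor j = marker a.
Proof.
rewrite /anchor size_cat !size_map nth_cat size_map => jA.
case: ltnP => jq; first by left; rewrite (nth_map 0%R) //; eexists.
right; case: ls jA => [|a l] jA; first by exfalso; move: jA => /=; lia.
by rewrite (nth_map a) ?size_map //; [eexists|lia].
Qed.

Lemma anchor_closed : closed r lvl x0 anchor.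
Proof.
move=> j k jA kA [l lr lj] ljk njk.
have h i : (i < size anchor)%N -> lev (nth x0 anchor i) = lvl l ->
    exists2 a, nth x0 anchor i = marker a & lvl l = Some a.
  move=> iA li; have [[q e]|[a e]] := anchorP iA.
    by case: (lvl_some lr); rewrite -li e lev_base_none.
  by exists a; rewrite // -li e lev_marker.
have [a ea la] := h j jA lj; have [b eb lb] := h k kA (etrans (esym ljk) lj).
by case: njk; rewrite ea eb; move: la; rewrite lb => -[->].
Qed.

Lemma anchor_levels : has_levels r lvl x0 anchor.
Proof.
move=> k kr; exists (size qs + k); first by rewrite size_cat !size_map ltn_add2l.
rewrite nth_cat size_map ltnNge leq_addr /= addKn.
case: ls kr => // a l kr; rewrite (nth_map a) // lev_marker.
by rewrite (nth_map a).
Qed.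

(** In the quantifier case the new point of the [B] side is adjoined together with the first
    differences it requires, and its word is then realised on the [A] side. *)
Lemma iso_sat n (phi : formula TL n) A B (s : 'I_n -> nat) :
    symbols_in (listed ls qs) phi ->
    closed r lvl x0 A -> iso r lvl x0 A B ->
    extends x0 anchor A -> extends x0 anchor B ->
    (forall i, (s i < size A)%N) ->
  @sat _ (tower_structure M) _ phi (fun i => nth x0 A (s i)) <->
  @sat _ (tower_structure M) _ phi (fun i => nth x0 B (s i)).
Proof.
have var k (t : term TL k) : exists i, t = Var _ i by case: t => [i|[]]; exists i.
elim: phi A B s => {n} [n|n t t'|n c ts|n phi IH psi IH'|n phi IH] A B s sy clA AB eA eB sA //=.
- have [i ->] := var _ t; have [j ->] := var _ t'; rewrite /=.
  split; first exact: (iso_eq AB).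
  have [sz _ _ _] := AB.
  by apply: (iso_eq (iso_sym AB)); rewrite -sz.
- have /choice[u uE] i := var _ (ts i).
  have evalE C : (fun i => @eval _ (tower_structure M) _ (fun i => nth x0 C (s i)) (ts i)) =
      (fun i => nth x0 C (s (u i))) by apply/funext => i; rewrite uE.
  rewrite !evalE {evalE}.
  have [sz lt st df] := AB.
  case: c ts u {uE} sy => [|a|a|q] ts u /=.
  + by move=> _; exact: lt.
  + by move=> [k kr <-]; exact: st.
  + move=> [k kr ka]; rewrite -ka; split=> -[l D].
      split; first exact/st.
      by apply/df => //; exists k.
    have l' := (st _ _ (sA _) kr).2 l; split=> //.
    by apply/df => //; exists k.
  + move=> qqs; have iq : (index q qs < size anchor)%N.
      by rewrite size_cat size_map ltn_addr // index_mem.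
    have aq : nth x0 anchor (index q qs) = base M q.
      by rewrite nth_cat size_map index_mem qqs (nth_map 0%R) ?index_mem // nth_index.
    have [szA hA] := eA; have [szB hB] := eB.
    have aA : nth x0 A (index q qs) = base M q by rewrite hA.
    have aB : nth x0 B (index q qs) = base M q by rewrite hB.
    rewrite -{1}aA -aB.
    have iA : (index q qs < size A)%N by exact: leq_trans szA.
    split; first exact: (iso_eq AB).
    by apply: (iso_eq (iso_sym AB)); rewrite -sz.
- by rewrite (IH A B) ?(IH' A B) //; case: sy.
- have half A1 B1 : closed r lvl x0 A1 -> iso r lvl x0 A1 B1 ->
      extends x0 anchor A1 -> extends x0 anchor B1 -> (forall i, (s i < size A1)%N) ->
      (forall x, @sat _ (tower_structure M) _ phi (vcons x (fun i => nth x0 A1 (s i)))) ->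
      forall y, @sat _ (tower_structure M) _ phi (vcons y (fun i => nth x0 B1 (s i))).
    move=> clA1 AB1 eA1 eB1 sA1 h y.
    have BA1 := iso_sym AB1; have clB1 := iso_closed AB1 clA1.
    have lvB1 : has_levels r lvl x0 B1.
      by have [sz hB] := eB1; exact: has_levelsW sz hB anchor_levels.
    have [B' [w [sB' _ _ _]]] := step_ex lvl_some y clB1 lvB1.
    have [x [A' sA']] := step_forth lvl_some clB1 BA1 sB'.
    have [BA' [p [pB' py px]]] := step_iso lvl_some clB1 BA1 sB' sA'.
    have AB' := iso_sym BA'; have [sz' _ _ _] := AB'; have [sz1 _ _ _] := AB1.
    have ext C C' z : extends x0 anchor C -> step r lvl x0 C z C' w ->
        extends x0 anchor C'.
      move=> eC sC; have sC' : steps r lvl x0 C [:: z] C' [:: w] by exists C'.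
      exact: steps_extends sC'.
    pose s' := vcons p s.
    have s'A i : (s' i < size A')%N.
      rewrite /s' /vcons; case: unliftP => [j|] _; last by rewrite sz'.
      exact: leq_trans (sA1 j) (step_size sA').
    have e C (C' : seq M) z : step r lvl x0 C z C' w -> (forall i, (s i < size C)%N) ->
        nth x0 C' p = z -> vcons z (fun i => nth x0 C (s i)) = fun i => nth x0 C' (s' i).
      move=> sC sz pz; apply/funext => i; rewrite /s' /vcons.
      by case: unliftP => [j|] _ //; rewrite (step_nth sC).
    rewrite (e B1 B') // -?sz1 //.
    apply/(IH A' B' s') => //.
    + exact: iso_closed BA' (step_closed lvl_some clB1 sB').
    + exact: ext sA'.
    + exact: ext sB'.
    by rewrite -(e A1 A' x).
  have [sz _ _ _] := AB.
  split; first exact: half.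
  apply: half; [exact: iso_closed clA|exact: iso_sym|by []|by []|by rewrite -sz].
Qed.

End Invariance.

Lemma tower_dependent : dependent (theory_of (tower_structure M)).
Proof.
apply: theory_of_dependent => n m phi.
have [ls [qs sy]] := symbols_listed phi.
apply: (@no_shattering _ M (size ls) (nth None (map Some ls)) (base M 0%R)
  (@lvl_some ls) (anchor ls qs) n m
  (fun a b => @sat _ (tower_structure M) _ phi (vcat a b))).
- exact: anchor_closed.
- exact: anchor_levels.
move=> A B s t clA AB eA eB sA tA.
have e C : vcat (fun i => nth (base M 0%R) C (s i)) (fun i => nth (base M 0%R) C (t i)) =
    fun i => nth (base M 0%R) C (vcat s t i).
  by apply/funext => i; rewrite /vcat; case: fintype.split.
rewrite !e; apply: (iso_sat sy clA AB eA eB _).1.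
by move=> i; rewrite /vcat; case: fintype.split.
Qed.

End TowerNIP.

(** * Cardinality of the models omitting the type *)

Lemma card_le_cover (T I X : Type) (S : I -> set T) :
    [set: nat] #<= [set: X] -> [set: I] #<= [set: X] ->
    (forall i, [set: {t | S i t}] #<= [set: X]) -> (forall t, exists i, S i t) ->
  [set: T] #<= [set: X].
Proof.
move=> natX /card_leTP[e einj] SX cov.
have /card_leTP[s sinj] := card_le_square natX.
pose F i := projT1 (cid ((card_leTP _ _).1 (SX i))).
have Finj i : injective (F i) by rewrite /F; case: cid.
have /choice[k kP] := cov.
apply/card_leTP; exists (fun t => s (e (k t), F (k t) (exist _ t (kP t)))).
move=> t u /sinj[/einj kk]; move: (kP t) (kP u); rewrite kk => p q.
by move=> /Finj[].
Qed.

Lemma cantor (T : Type) : ~ ([set: set T] #<= [set: T]).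
Proof.
move=> /card_leTP[f finj].
pose D : set T := [set n | exists2 A : set T, f A = n & ~ A n].
have [fD|nfD] := pselect (D (f D)); last by apply: (nfD); exists D.
by have [A /finj ->] := fD; apply.
Qed.

Lemma card_le_existT (I : Type) (B : I -> Type) (i : I) :
  [set: B i] #<= [set: {i & B i}].
Proof.
apply/card_leTP; exists (existT B i) => x y e.
by have := projT2_eq e; rewrite (Prop_irrelevance (projT1_eq e) erefl).
Qed.

(** * Growth of the beth sequence *)

Section Beth.
Variable W : wellOrder.

Lemma nat_le_beth_at (a : W) : [set: nat] #<= [set: beth_at a].
Proof.
elim/(well_founded_ind (@wo_lt_wf W)): a => a IH; rewrite beth_atE /beth_step.
case: pselect => // -[b _]; case: pselect => [hm|_].
  case: cid => m _ /=; apply: card_le_trans (card_le_powerset _).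
  exact: IH (svalP m).
exact: card_le_trans (IH _ (svalP b)) (card_le_existT _ b).
Qed.

Lemma set_beth_at_le (a b : W) : wo_lt a b -> [set: set (beth_at a)] #<= [set: beth_at b].
Proof.
elim/(well_founded_ind (@wo_lt_wf W)): b => b IH ab.
pose a' : wo_seg b := exist _ a ab.
rewrite (beth_atE b) /beth_step; case: pselect => [_|[]]; last by exists a'.
case: pselect => [hm|nm].
  case: cid => m mP /=; apply: card_le_set; have [<- //|am] := mP a'.
  exact: card_le_trans (card_le_powerset _) (IH _ (svalP m) am).
have [c ac] : exists c : wo_seg b, wo_lt a (sval c).
  apply: contrapT => nc; apply: nm; exists a' => c.
  have [->|ca|ac] := wo_lt_total c a'; [by left|by right|].
  by case: nc; exists c.
exact: card_le_trans (IH _ (svalP c) ac) (card_le_existT _ c).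
Qed.

Lemma beth_at_le (a b : W) : wo_lt a b -> [set: beth_at a] #<= [set: beth_at b].
Proof. by move=> /set_beth_at_le; exact: card_le_trans (card_le_powerset _). Qed.

End Beth.

(** Otherwise [omega1] would be a countable union of countable initial segments. *)
Lemma omega1_bound (I : Type) (f : I -> omega1) : countable [set: I] ->
  exists o, forall i, wo_lt (f i) o.
Proof.
move=> cI; apply: contrapT => /forallNP nb; apply: omega1_uncountable.
have /choice[g gP] i := omega1_limit (f i).
apply: (@card_le_cover _ I _ (fun i => [set o | wo_lt o (g i)])) => //.
  by move=> i; exact: omega1_seg_countable.
move=> o; have /existsNP[i nfi] := nb o; exists i.
have [->|oi|//] := wo_lt_total o (f i); first exact: gP.
exact: wo_lt_trans oi (gP i).
Qed.

Lemma beth_omega1_gt (N : Type) (o : omega1) :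
  [set: N] #<= [set: beth_at o] -> card_lt N (beth omega1).
Proof.
move=> No; have [o' oo'] := omega1_limit o.
have le : [set: set (beth_at o)] #<= [set: beth omega1].
  rewrite beth_limE; [|by exists o|exact: omega1_limit].
  exact: card_le_trans (set_beth_at_le oo') (card_le_existT _ o').
split; first exact: card_le_trans No (card_le_trans (card_le_powerset _) le).
by move=> leN; apply: (@cantor (beth_at o)); exact: card_le_trans le (card_le_trans leN No).
Qed.

(** The graphs [D _ _ i] are disjoint unions of complete bipartite graphs, and
    the side of [x] in each of them determines [x]. *)
Lemma card_le_bipartite (N I : Type) (U : set N) (D : N -> N -> I -> Prop) :
    (forall x y, U x -> U y -> x <> y -> exists i, D x y i) ->
    (forall x i, ~ D x x i) ->
    (forall x y i, D x y i -> D y x i) ->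
    (forall x y z t i, D x y i -> D y z i -> D z t i -> D x t i) ->
  [set: {x | U x}] #<= [set: set I].
Proof.
move=> ex irr sym path3.
pose V := WellOrder (svalP (well_ordering_principle {classic N})).
pose lt (x y : N) := @wo_lt V x y.
(* This says that, in the component of [x] in the graph of [i], the least element for [lt] lies
   opposite [x]; of two opposite vertices exactly one has this property. *)
pose side (x : N) : set I :=
  [set i | exists2 y, D x y i & forall z, D y z i -> lt y z].
have one x y i : D x y i -> ~ (side x i /\ side y i).
  move=> xy [[u xu um] [v yv vm]].
  have uv : D u v i by apply: path3 (sym _ _ _ xu) xy yv.
  by apply: (@wo_lt_asym V u v); [exact: um|apply: vm; exact: sym].
have some x y i : D x y i -> side x i \/ side y i.
  move=> xy.
  have [|m mxy mmin] := @wo_min V [set z | D x z i \/ D y z i].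
    by exists y; left.
  have key z u v : (forall t, D x t i \/ D y t i <-> D u t i \/ D v t i) ->
      D u v i -> D u m i -> D m z i -> lt m z.
    move=> e uv um mz; have vz : D v z i by apply: path3 (sym _ _ _ uv) um mz.
    have [mz'|//|zm] := wo_lt_total (m : V) z; first by case: (irr m i); rewrite {2}mz'.
    by case/negP: zm; apply: mmin; apply/e; right.
  case: mxy => [xm|ym]; [left|right]; exists m => // z; first exact: (key z x y).
  by apply: (key z y x) => //; [move=> t; tauto|exact: sym].
apply/card_leTP; exists (fun x => side (sval x)) => -[x Ux] [y Uy] /= e.
have [xy|nxy] := pselect (x = y); first by apply: sval_injective.
have [i xyi] := ex x y Ux Uy nxy.
by case: (one x y i xyi); move: (some x y i xyi); rewrite -e => -[].
Qed.

(** * Models omitting the type *)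

Section UpperBound.
Variables (W : wellOrder) (M : tower W).
Local Notation TL := (tower_language W).
Local Notation T := (theory_of (tower_structure M)).

Definition lev_atom n (a : W) (i : 'I_n) : formula TL n :=
  @Rel TL n (SLev a) (fun=> Var _ i).
Definition base_atom n (q : rat) (i : 'I_n) : formula TL n :=
  @Rel TL n (SBase q) (fun=> Var _ i).
Definition diff_atom n (a : W) (i j k : 'I_n) : formula TL n :=
  @Rel TL n (SDiff a) (fun t : 'I_3 => Var _ (nth i [:: i; j; k] t)).
Definition Ex n (phi : formula TL n.+1) : formula TL n := Neg (All (Neg phi)).

Definition outside_type : set (formula TL 1) :=
  [set phi | (exists a, phi = Neg (lev_atom a ord0)) \/
             (exists q, phi = Neg (base_atom q ord0))].

Section Models.
Variable N : structure TL.

Definition lev_in (a : W) (x : N) : Prop := @rint TL N (SLev a) (fun=> x).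
Definition base_in (q : rat) (x : N) : Prop := @rint TL N (SBase q) (fun=> x).
Definition diff_in (a : W) (x y z : N) : Prop :=
  @rint TL N (SDiff a) (fun t : 'I_3 => nth x [:: x; y; z] t).

Lemma sat_diff n (v : 'I_n -> N) a i j k :
  sat (diff_atom a i j k) v <-> diff_in a (v i) (v j) (v k).
Proof.
rewrite /diff_in /=.
by rewrite (_ : (fun t : 'I_3 => v _) = (fun t : 'I_3 => nth (v i) [:: v i; v j; v k] t)) //;
  apply/funext => -[[|[|[|?]]] ?].
Qed.

Lemma sat_Ex n (phi : formula TL n.+1) (v : 'I_n -> N) :
  sat (Ex phi) v <-> exists x, sat phi (vcons x v).
Proof.
split=> [h|[x h] nh]; last exact: nh h.
by apply: contrapT => nx; apply: h => x px; apply: nx; exists x.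
Qed.

End Models.

Lemma diff_in_tower a (x y z : M) :
  @diff_in (tower_structure M) a x y z <-> lev x = Some a /\ diff x y z.
Proof. by []. Qed.

Section ModelOf.
Variable N : structure TL.
Hypothesis NT : models N T.

Let vec n (s : seq N) (x : N) : 'I_n -> N := fun j => nth x s j.

Lemma diff_in_ex a (x y : N) : lev_in a x -> lev_in a y -> x <> y ->
  exists i, diff_in a x y i.
Proof.
pose o k (kn : (k < 2)%N) := @Ordinal 2 k kn.
pose psi := diff_atom a (lift ord0 (o 0 isT)) (lift ord0 (o 1 isT)) ord0.
pose phi := Imp (lev_atom a (o 0 isT)) (Imp (lev_atom a (o 1 isT))
  (Imp (Neg (Eql (Var _ (o 0 isT)) (Var _ (o 1 isT)))) (Ex psi))).
have h : forall v, sat (M := tower_structure M) phi v.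
  move=> v l0 l1 ne; apply/(@sat_Ex (tower_structure M) 2 psi v).
  have [|||i D] := @diff_ex _ M (v (o 0 isT)) (v (o 1 isT)).
  - by move=> e; apply: ne.
  - by rewrite l0 l1.
  - by rewrite l0.
  by exists i; apply/sat_diff; rewrite !vconsS vcons0; apply/diff_in_tower.
move=> lx ly xy; have := theory_of_transfer NT h (@vec 2 [:: x; y] x) lx ly xy.
by move=> /(@sat_Ex N 2 psi)[i /sat_diff]; rewrite !vconsS vcons0 => D; exists i.
Qed.

Lemma diff_in_irr a (x i : N) : ~ diff_in a x x i.
Proof.
pose o k (kn : (k < 2)%N) := @Ordinal 2 k kn.
pose phi := Neg (diff_atom a (o 0 isT) (o 0 isT) (o 1 isT)).
have h : forall v, sat (M := tower_structure M) phi v.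
  by move=> v /sat_diff/diff_in_tower[_ /diff_irr].
move=> D; apply: (theory_of_transfer NT h (@vec 2 [:: x; i] x)).
exact/sat_diff.
Qed.

Lemma diff_in_sym a (x y i : N) : diff_in a x y i -> diff_in a y x i.
Proof.
pose o k (kn : (k < 3)%N) := @Ordinal 3 k kn.
pose phi := Imp (diff_atom a (o 0 isT) (o 1 isT) (o 2 isT))
                (diff_atom a (o 1 isT) (o 0 isT) (o 2 isT)).
have h : forall v, sat (M := tower_structure M) phi v.
  move=> v /sat_diff/diff_in_tower[l0 D].
  apply/(@sat_diff (tower_structure M) 3 v a (o 1 isT) (o 0 isT) (o 2 isT)).
  apply/diff_in_tower; by split; [case: D => <-|exact: diff_sym].
move=> D; apply/(@sat_diff N 3 (@vec 3 [:: x; y; i] x) a (o 1 isT) (o 0 isT) (o 2 isT)).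
by apply: (theory_of_transfer NT h); exact/sat_diff.
Qed.

Lemma diff_in_path3 a (x y z t i : N) :
  diff_in a x y i -> diff_in a y z i -> diff_in a z t i -> diff_in a x t i.
Proof.
pose o k (kn : (k < 5)%N) := @Ordinal 5 k kn.
pose phi := Imp (diff_atom a (o 0 isT) (o 1 isT) (o 4 isT))
  (Imp (diff_atom a (o 1 isT) (o 2 isT) (o 4 isT))
    (Imp (diff_atom a (o 2 isT) (o 3 isT) (o 4 isT))
         (diff_atom a (o 0 isT) (o 3 isT) (o 4 isT)))).
have h : forall v, sat (M := tower_structure M) phi v.
  move=> v /sat_diff/diff_in_tower[l0 D] /sat_diff/diff_in_tower[_ D'].
  move=> /sat_diff/diff_in_tower[_ D''].
  apply/(@sat_diff (tower_structure M) 5 v a (o 0 isT) (o 3 isT) (o 4 isT)).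
  apply/diff_in_tower; by split=> //; exact: diff_path3 D D' D''.
move=> D D' D''.
apply/(@sat_diff N 5 (@vec 5 [:: x; y; z; t; i] x) a (o 0 isT) (o 3 isT) (o 4 isT)).
by apply: (theory_of_transfer NT h); exact/sat_diff.
Qed.

Lemma diff_in_lev a b (x y i : N) : diff_in a x y i -> lev_in b i -> wo_lt b a.
Proof.
move=> D lb; apply: contrapT => nba.
pose o k (kn : (k < 3)%N) := @Ordinal 3 k kn.
pose phi := Imp (diff_atom a (o 0 isT) (o 1 isT) (o 2 isT)) (Neg (lev_atom b (o 2 isT))).
have h : forall v, sat (M := tower_structure M) phi v.
  move=> v /sat_diff/diff_in_tower[l0 [_ li _]] /= lb'; apply: nba.
  by move: li; rewrite l0; move: lb' => /= ->.
apply: (theory_of_transfer NT h (@vec 3 [:: x; y; i] x)) lb.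
exact/sat_diff.
Qed.

Lemma base_in_uniq q (x y : N) : base_in q x -> base_in q y -> x = y.
Proof.
pose o k (kn : (k < 2)%N) := @Ordinal 2 k kn.
pose phi := Imp (base_atom q (o 0 isT)) (Imp (base_atom q (o 1 isT))
  (Eql (Var _ (o 0 isT)) (Var _ (o 1 isT)))).
have h : forall v, sat (M := tower_structure M) phi v.
  by move=> v /= -> ->.
exact: (theory_of_transfer NT h (@vec 2 [:: x; y] x)).
Qed.

Hypothesis NO : omits N outside_type.

Lemma omits_cover (x : N) : (exists q, base_in q x) \/ (exists a, lev_in a x).
Proof.
apply: contrapT => /not_orP[nb nl]; apply: (NO (x := x)) => phi.
by move=> [[a ->]|[q ->]] /= h; [apply: nl; exists a|apply: nb; exists q].
Qed.

Hypothesis countW : countable [set: W].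

Lemma card_le_levels (X : Type) (U : set N) (J : set W) :
    [set: nat] #<= [set: X] ->
    (forall a, J a -> [set: {x : N | lev_in a x}] #<= [set: X]) ->
    (forall x, U x -> (exists q, base_in q x) \/ exists2 a, J a & lev_in a x) ->
  [set: {x | U x}] #<= [set: X].
Proof.
move=> natX JX cov; pose I := (rat + {a | J a})%type.
pose S (i : I) : set {x | U x} := [set x | match i with
  | inl q => base_in q (sval x) | inr a => lev_in (sval a) (sval x) end].
apply: (@card_le_cover _ I _ S) => //.
- have /card_leTP[f finj] := countW.
  apply: card_le_trans natX; apply: card_le_trans (@card_le_countable (rat + nat)%type nat _) => //.
  apply/card_leTP; exists (fun i : I => match i with
    | inl q => inl q | inr a => inr (f (sval a)) end).
  by move=> [q|a] [q'|a'] // []; [move=> ->|move=> /finj/sval_injective ->].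
- case=> [q|a].
    have /card_leTP[e _] := natX; apply/card_leTP; exists (fun=> e 0).
    by move=> [x bx] [y by'] _; apply/sval_injective/sval_injective; exact: base_in_uniq bx by'.
  have /card_leTP[f finj] := JX _ (svalP a).
  apply/card_leTP; exists (fun x : {x | S (inr a) x} =>
    f (exist (fun x : N => lev_in (sval a) x) (sval (sval x)) (svalP x))).
  by move=> x y /finj[] /sval_injective/sval_injective.
- move=> [x Ux]; have [[q bq]|[a Ja la]] := cov x Ux; first by exists (inl q).
  by exists (inr (exist _ a Ja)).
Qed.

(** The induction runs over the level names in [W], which are well-ordered even though [N] need not
    resemble the tower. *)
Lemma level_card (a : W) :
  exists o : omega1, [set: {x : N | lev_in a x}] #<= [set: beth_at o].
Proof.
elim/(well_founded_ind (@wo_lt_wf W)): a => a IH.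
have [o1 _] : exists o : omega1, True.
  apply: contrapT => no; apply: omega1_uncountable; apply/card_leTP.
  by exists (fun=> 0) => x; case: no; exists x.
have /choice[f fP] (b : W) : exists o : omega1, wo_lt b a ->
    [set: {x : N | lev_in b x}] #<= [set: beth_at o].
  have [ba|nba] := pselect (wo_lt b a); last by exists o1.
  by have [o oP] := IH b ba; exists o.
have [o oP] := omega1_bound f countW; have [o' oo'] := omega1_limit o.
exists o'; apply: card_le_trans (set_beth_at_le oo').
(* The places where level [a] splits. As [N] omits the type, each is named or lies in a level below
   [a], so the induction hypothesis bounds their number. *)
pose Lo := {i : N | exists x y, diff_in a x y i}.
have LoX : [set: Lo] #<= [set: beth_at o].
  apply: (@card_le_levels _ _ [set b | wo_lt b a]); first exact: nat_le_beth_at.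
    by move=> b ba; exact: card_le_trans (fP b ba) (beth_at_le (oP b)).
  move=> i [x [y D]]; have [?|[b lb]] := omits_cover i; first by left.
  by right; exists b => //; exact: diff_in_lev D lb.
apply: card_le_trans (card_le_set LoX).
apply: (@card_le_bipartite N Lo _ (fun x y i => diff_in a x y (sval i))).
- move=> x y lx ly xy; have [i D] := diff_in_ex lx ly xy.
  have Di : exists x y, diff_in a x y i by exists x, y.
  by exists (exist _ i Di).
- by move=> x i /diff_in_irr.
- by move=> x y i /diff_in_sym.
- by move=> x y z t i; exact: diff_in_path3.
Qed.

Lemma omitting_card : card_lt N (beth omega1).
Proof.
have /choice[f fP] := level_card.
have [o oP] := omega1_bound f countW.
apply: (@beth_omega1_gt _ o).
have le : [set: {x : N | True}] #<= [set: beth_at o].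
  apply: (@card_le_levels _ _ setT); first exact: nat_le_beth_at.
    by move=> a _; exact: card_le_trans (fP a) (beth_at_le (oP a)).
  by move=> x _; have [?|[a la]] := omits_cover x; [left|right; exists a].
apply: card_le_trans le; apply/card_leTP.
by exists (fun x => exist _ x I) => x y [].
Qed.

End ModelOf.

(** Finitely many formulas exclude finitely many named rationals, and any other named rational,
    lying in no level of [W], realises them. *)
Lemma outside_type_partial : partial_type T outside_type.
Proof.
move=> q finq qp; exists (tower_structure M); first by move=> phi.
apply: contrapT => /forallNP nq.
have inq r : q (Neg (base_atom r ord0)).
  have /existsNP[phi /not_implyP[qphi nphi]] := nq (base M r).
  have [[a e]|[s e]] := qp _ qphi; subst phi.
    case: nphi => /=; rewrite (_ : lev _ = None) //.
    by apply/lev_base; exists r.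
  suff -> : r = s by [].
  by apply: contrapT => rs; apply: nphi => /= /(@base_inj _ M).
pose f (n : nat) : formula TL 1 := Neg (base_atom n%:R%R ord0).
have finj : injective f.
  move=> m n /(congr1 (fun phi : formula TL 1 =>
    if phi is Imp (Rel (SBase s) _) _ then s else 0%R)) /= /eqP.
  by rewrite Num.Theory.eqr_nat => /eqP.
apply: infinite_nat; have : finite_set (range f).
  by apply: sub_finite_set finq => _ [n _ <-]; exact: inq.
by rewrite (eq_finite_set (inj_card_eq _)) // => m n _ _ /finj.
Qed.

Lemma outside_type_omitted : omits (tower_structure M) outside_type.
Proof.
move=> x h; case lx : (lev x) => [a|].
  by apply: (h (Neg (lev_atom a ord0))); [left; exists a|].
have [q xq] := (lev_base x).1 lx.
by apply: (h (Neg (base_atom q ord0))); [right; exists q|].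
Qed.

End UpperBound.

(** * Countability of the language and conclusion *)

Lemma tower_language_countable (W : Type) : countable [set: W] ->
  countable_language (tower_language W).
Proof.
move=> /card_leTP[f finj]; split.
  by apply/card_leTP; exists (fun=> 0) => -[].
apply: card_le_trans (@card_le_countable (nat * rat * nat)%type nat _) => //.
apply/card_leTP; exists (fun s : tower_symbol W => match s with
  | SLt => (0, 0%R, 0) | SLev a => (1, 0%R, f a)
  | SDiff a => (2, 0%R, f a) | SBase q => (3, q, 0) end).
by move=> [|a|a|q] [|b|b|r] // []; [move=> /finj ->|move=> /finj ->|move=> ->].
Qed.

Theorem theorem4p5 (beta : wellOrder) (beta_countable : countable [set: beta]) :
  exists (L : language) (T : theory L) (p : set (formula L 1)),
    [/\ countable_language L, complete T, dependent T & partial_type T p] /\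
    (exists M : structure L,
        [/\ models M T, omits M p & [set: beth beta] #<= [set: M]]) /\
    (forall M : structure L, models M T -> omits M p -> card_lt M (beth omega1)).
Proof.
pose M := the_tower beta.
exists (tower_language beta), (theory_of (tower_structure M)), (@outside_type beta).
split; first split.
- exact: tower_language_countable.
- exact: theory_of_complete.
- exact: tower_dependent.
- exact: outside_type_partial.
split; last by move=> N NT NO; exact: omitting_card NT NO beta_countable.
exists (tower_structure M); split.
- by move=> phi.
- exact: outside_type_omitted.
- exact: beth_le_tower.
Qed.
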